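(* For every integer $k \ge 1$, every $(2k+2)$-regular graph is antimagic.
   Context: Graphs are finite and simple. For a graph $G=(V,E)$ and a bijection $f: E \to \{1,2,\ldots,|E|\}$, the vertex-sum at a vertex $u$ is $\varphi_f(u)=\sum_{e \in E(u)} f(e)$, where $E(u)$ is the set of edges incident to $u$. The bijection $f$ is an antimagic labeling if $\varphi_f(u) \ne \varphi_f(v)$ for any two distinct vertices $u,v$ of $G$, and $G$ is antimagic if it has an antimagic labeling. *)

(* Defs.v *)
From mathcomp Require Import all_boot.

Set Implicit Arguments.
Unset Strict Implicit.
Unset Printing Implicit Defensive.

(* A finite simple graph is a symmetric irreflexive relation [e] on a finite
   type [V]; its edges are the unordered pairs [set x; y] with [e x y]. *)
Definition simple_graph (V : finType) (e : rel V) : Prop :=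
  symmetric e /\ irreflexive e.

Definition edges (V : finType) (e : rel V) : {set {set V}} :=
  [set [set p.1; p.2] | p : V * V & e p.1 p.2].

Definition regular (V : finType) (e : rel V) (d : nat) : Prop :=
  forall u : V, #|[set v | e u v]| = d.

Definition incident_edges (V : finType) (e : rel V) (u : V) : {set {set V}} :=
  [set A in edges e | u \in A].

(* A labeling is a total function on {set V}; only its values on [edges e]
   are constrained or used. *)
Definition edge_bijection (V : finType) (e : rel V) (f : {set V} -> nat) :
    Prop :=
  [/\ forall A, A \in edges e -> 1 <= f A <= #|edges e|,
      {in edges e &, injective f}
    & forall i, 1 <= i <= #|edges e| -> exists2 A, A \in edges e & f A = i].

Definition vertex_sum (V : finType) (e : rel V) (f : {set V} -> nat) (u : V) :
    nat :=
  \sum_(A in incident_edges e u) f A.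

Definition antimagic_labeling (V : finType) (e : rel V) (f : {set V} -> nat) :
    Prop :=
  edge_bijection e f /\
  forall u v : V, u != v -> vertex_sum e f u <> vertex_sum e f v.

Definition antimagic (V : finType) (e : rel V) : Prop :=
  exists f : {set V} -> nat, antimagic_labeling e f.

(* Main.v *)
(** Level the vertices of each component by their distance to a root and label the edges
    from the farthest level inwards: since all degrees are equal to [d = 2k + 2], a vertex
    two or more levels closer to the root has a larger sum.  Every non-root vertex [v]
    keeps the edge to a parent [par v] for the end of its level; these parent edges get the
    largest labels of the level, ranked by the sums reached so far, which separates the
    vertices of a level.

    Two consecutive levels can only collide at vertices that have [d - 1] edges to the
    farther level and are the parent of nobody.  Each such [w] (the set [Y]) owns a private
    token vertex [f w] at the farther level, all of whose edges go towards the root.  The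
    edge between [f w] and [w] is labelled late, so that the sum at [w] without its parent
    edge is exactly [c0 + idx w].  The tokens with their large ranks are placed so that their
    sums avoid, by parity or by size, the sums that the vertices of [Y] will reach.

    The remaining edges between two levels form a bipartite graph.  It is decomposed into
    few trails, whose labels alternate from both ends of an interval: consecutive labels
    then have a constant sum at each side, and the sum at a vertex only depends on its
    degree up to the labels of at most two trail ends. *)
Require Import Defs.
From mathcomp Require Import all_boot zify.
From Stdlib Require Import Classical.

Set Implicit Arguments.
Unset Strict Implicit.
Unset Printing Implicit Defensive.

(** * Balanced choice functions *)

(** Evenness of the degree is what makes the exact value at [Y] possible. A vertex of [Y] keeps
    [2 * k] free edges to the farther level, and alternating labels give a vertex of even free
    degree on the closer side a sum determined by that degree. A token has [2 * k + 2] edges towards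
    the root, hence [2 * k] free ones besides its parent and token edges; its free sum is exact up
    to the excess [del] of a block of trails based at it.

    Another non-root vertex of the closer level either is somebody's parent or still has, besides
    its parent edge, an edge to be labelled later; one such label outweighs a token label. So the
    vertices of [Y] come first when their level is ranked, the one of index [x] gets rank [x], and
    its final sum is a constant plus [2 * x]. The step 2 leaves a parity class to the tokens.

    The load balancing provides [(2 * k).+1] vertices with all edges towards the root per token;
    this is the room that the tokens need among the large ranks. *)

Lemma sum_nat_D2 (T : finType) (F : T -> nat) (u x : T) : u != x ->
  \sum_i F i = F u + F x + \sum_(i | (i != u) && (i != x)) F i.
Proof. by move=> ux; rewrite (bigD1 u) //= (bigD1 x) 1?eq_sym //= addnA. Qed.

Section Cover.
Variables (T : finType) (r : rel T) (A B : pred T) (c : nat).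
Hypothesis c_gt0 : 0 < c.
Hypothesis rB : forall w, B w -> #|[set u | r u w]| = c.
Hypothesis rA : forall u, #|[set w | r u w & B w]| <= c + A u.

Definition fiber (f : T -> T) u := [set w | B w & f w == u].
Let adm (f : {ffun T -> T}) := [forall w, B w ==> r (f w) w].
(* At a minimum, moving one unit of load along a path of [st] cannot help, so no fiber
   exceeds two and fibers of size two lie over [A]. *)
Let pot (f : {ffun T -> T}) :=
  \sum_u (2 * #|fiber f u| ^ 2 + (~~ A u) * #|fiber f u|).
Let st (f : {ffun T -> T}) := [rel x y | [exists w in fiber f x, r y w]].

(** The rest of the path is shifted first. As the path has no repetition, this does not touch [w],
    which then moves from [x] to [y]; the changes at inner vertices cancel. *)
Lemma fiber_shift f p x : adm f -> path (st f) x p -> uniq (x :: p) ->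
  exists f', [/\ adm f',
    forall z, #|fiber f' z| + (z == x) = #|fiber f z| + (z == last x p) &
    forall w, f w \notin x :: p -> f' w = f w].
Proof.
elim: p x => [|y q IH] x admf.
  by move=> _ _; exists f; split.
rewrite /= => /andP[/exists_inP[w wx ryw] pq] /andP[xyq uq].
have [f' [admf' card_f' f'E]] := IH y admf pq uq.
have /andP[Bw /eqP fwx] : B w && (f w == x) by move: wx; rewrite inE.
have f'wx : f' w = x by rewrite f'E ?fwx.
have xy : x != y by apply: contraNneq xyq => ->; rewrite mem_head.
exists [ffun v => if v == w then y else f' v]; split.
- apply/forallP=> v; apply/implyP=> Bv; rewrite ffunE; case: eqP => [->//|_].
  by move/forallP/(_ v): admf'; rewrite Bv.
- move=> z; have := card_f' z.
  have [->|zx] := eqVneq z x.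
    rewrite (negPf xy) addn0 addn1 => <-.
    have -> : fiber f' x = w |: fiber [ffun v => if v == w then y else f' v] x.
      apply/setP=> v; rewrite !inE ffunE; have [->|_] := eqVneq v w => //=.
      by rewrite Bw f'wx eqxx.
    by rewrite cardsU1 inE ffunE eqxx eq_sym (negPf xy) andbF addnC addn1.
  have [->|zy] := eqVneq z y.
    rewrite addn1 addn0 => <-.
    have -> : fiber [ffun v => if v == w then y else f' v] y = w |: fiber f' y.
      apply/setP=> v; rewrite !inE ffunE; have [->|_] := eqVneq v w => //=.
      by rewrite Bw eqxx.
    by rewrite cardsU1 inE f'wx (negPf xy) andbF.
  rewrite !addn0 => <-; congr #|pred_of_set _|; apply/setP=> v.
  rewrite !inE ffunE; have [->|_] := eqVneq v w => //=.
  by rewrite f'wx (eq_sym y) (eq_sym x) (negPf zx) (negPf zy).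
- move=> v; rewrite inE negb_or => /andP[fvx fvq]; rewrite ffunE.
  case: eqP => [vw|_]; last exact: f'E.
  by move: fvx; rewrite vw fwx eqxx.
Qed.

(** Double counting of the pairs of [r]: by closedness, all [c] neighbours of an element assigned
    into [R] lie in [R]. *)
Lemma fiber_closed f (R : pred T) : adm f ->
  (forall x y, R x -> st f x y -> R y) ->
  c * (\sum_(u | R u) #|fiber f u|) <= \sum_(u | R u) (c + A u).
Proof.
move=> admf Rst; pose X := [set w | B w & R (f w)].
have -> : \sum_(u | R u) #|fiber f u| = #|X|.
  rewrite -sum1_card [RHS](partition_big f R) /=; last by move=> w; rewrite inE => /andP[].
  apply: eq_bigr => u Ru; rewrite -sum1_card; apply: eq_bigl => w.
  by rewrite /X !inE; case: eqP => [->|]; rewrite ?Ru ?andbT ?andbF.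
apply: (@leq_trans (\sum_(w in X) \sum_(u | R u) r u w)).
  rewrite mulnC -sum_nat_const; apply: leq_sum => w.
  rewrite /X inE => /andP[Bw Rw]; rewrite -(rB Bw) -sum1dep_card big_mkcond /=.
  rewrite [X in _ <= X]big_mkcond /=; apply: leq_sum => u _.
  have [ruw|] := boolP (r u w); last by case: (R u).
  rewrite (_ : R u) //; apply: (Rst (f w)) => //.
  by apply/exists_inP; exists w; rewrite // inE Bw eqxx.
rewrite exchange_big /=; apply: leq_sum => u Ru; apply: leq_trans (rA u).
rewrite -sum1dep_card [X in _ <= X]big_mkcond /= big_mkcond /=.
by apply: leq_sum => w _; rewrite /X inE; case: (B w); case: (r u w); case: (R _).
Qed.

(** Moving one unit from [u] to [x] changes the quadratic part of [pot] by four times the difference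
    of the loads plus 4. The factor 2 makes loads decide first; membership in [A] matters only for
    loads that differ by one. *)
Lemma pot_min f : adm f -> (forall f', adm f' -> pot f <= pot f') ->
  forall u x, connect (st f) u x -> u != x ->
  4 * #|fiber f u| + ~~ A u <= 4 * #|fiber f x| + 4 + ~~ A x.
Proof.
move=> admf minf u x /connectP[p pp lastp] ux.
move: lastp; case: (shortenP pp) => p' pp' up' _ lastp.
have [f' [admf' card_f' _]] := fiber_shift admf pp' up'.
rewrite -lastp in card_f'.
have := minf f' admf'; rewrite /pot.
rewrite !(sum_nat_D2 _ ux).
have -> : \sum_(i | (i != u) && (i != x)) (2 * #|fiber f' i| ^ 2 + ~~ A i * #|fiber f' i|)
  = \sum_(i | (i != u) && (i != x)) (2 * #|fiber f i| ^ 2 + ~~ A i * #|fiber f i|).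
  apply: eq_bigr => z /andP[zu zx]; have := card_f' z.
  by rewrite (negPf zu) (negPf zx) !addn0 => ->.
rewrite leq_add2r.
have := card_f' u; rewrite eqxx (negPf ux) addn0 addn1 => <-.
have := card_f' x; rewrite eqxx (eq_sym x) (negPf ux) addn0 addn1 => ->.
case: (A u); case: (A x); rewrite /=; nia.
Qed.

Lemma balanced_choice : exists f : T -> T,
  [/\ forall w, B w -> r (f w) w,
      forall u, #|fiber f u| <= 2,
      forall u, #|fiber f u| = 2 -> A u &
      forall Q : pred T, (forall u u' w, r u w -> r u' w -> Q u -> Q u') ->
        c * #|[set u | Q u & #|fiber f u| == 2]| <= #|[set u | Q u & A u]|].
Proof.
have adm0 : adm [ffun w => odflt w [pick u | r u w]].
  apply/forallP=> w; apply/implyP=> Bw; rewrite ffunE; case: pickP => //= r0.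
  by have := c_gt0; rewrite -(rB Bw) => /card_gt0P[u]; rewrite inE r0.
have [f admf minf] := arg_minnP pot adm0.
have min2 := pot_min admf minf.
have sumC u : \sum_(x | connect (st f) u x) (c + A x) =
    c * #|[set x | connect (st f) u x]| + \sum_(x | connect (st f) u x) A x.
  by rewrite big_split /= sum_nat_const mulnC cardsE.
have clos u x y : connect (st f) u x -> st f x y -> connect (st f) u y.
  by move=> ux xy; apply: connect_trans ux (connect1 xy).
have le2 u : #|fiber f u| <= 2.
  (* A load of three at [u] forces at least two on everything reachable: more than [2 * n] on [n]
     vertices, too much for [fiber_closed]. *)
  rewrite leqNgt; apply/negP=> u3.
  have := fiber_closed admf (clos u).
  have : \sum_(x | connect (st f) u x) (2 + (x == u)) <= \sum_(x | connect (st f) u x) #|fiber f x|.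
    apply: leq_sum => x ux; have [->|xu] := eqVneq x u; first by rewrite addn1.
    by have := min2 _ _ ux; rewrite eq_sym => /(_ xu); case: (A x); case: (A u); lia.
  rewrite big_split /= sum_nat_const (bigD1 u) //= eqxx.
  have : \sum_(x | connect (st f) u x) (c + A x) <= \sum_(x | connect (st f) u x) (c + 1).
    by apply: leq_sum => x _; rewrite leq_add2l; case: (A x).
  rewrite sum_nat_const; set S := \sum_(i | _) #|_|.
  have : 0 < #|[pred x | connect (st f) u x]| by apply/card_gt0P; exists u; rewrite inE.
  set n := #|_| => n0 h1 h2 h3.
  have {}h2 : n * 2 + 1 <= S by rewrite (leq_trans _ h2) // leq_add2l leq_addr.
  have h4 := leq_trans h3 h1; have := leq_mul (leqnn c) h2.
  by have := leq_pmull n c_gt0; have := c_gt0; move: h4; clear; nia.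
have leA u : #|fiber f u| = 2 -> A u.
  (* A load of two outside [A] forces at least [1 + A x] on every reachable [x], and [u] itself
     carries one more. *)
  move=> u2; apply: contraT => nAu.
  have := fiber_closed admf (clos u); rewrite big_split /=.
  have : \sum_(x | connect (st f) u x) (1 + A x + (x == u)) <= \sum_(x | connect (st f) u x) #|fiber f x|.
    apply: leq_sum => x ux; have [->|xu] := eqVneq x u; first by rewrite (negPf nAu) u2.
    by have := min2 _ _ ux; rewrite eq_sym => /(_ xu); rewrite u2 nAu; case: (A x); lia.
  rewrite 2!big_split /= !sum_nat_const (bigD1 u (F := fun x => nat_of_bool (x == u))) //= eqxx.
  set n := #|_|; set S := \sum_(i | _) #|_|; set a := \sum_(i | _) A i; nia.
exists f; split=> // [w Bw|Q invQ]; first by move/forallP/(_ w): admf; rewrite Bw.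
(* All vertices reachable from a load of two inside [Q] carry at least one, those of load two one
   more; [fiber_closed] then charges [c] elements of [A] to each load of two. *)
pose R x := [exists u, [&& Q u, #|fiber f u| == 2 & connect (st f) u x]].
have RQ x : R x -> Q x.
  case/existsP=> u /and3P[Qu _ /connectP[p pp ->]].
  elim: p u Qu pp => //= y p IH u Qu /andP[/exists_inP[w]].
  rewrite inE => /andP[Bw /eqP fw] ryw; apply: IH; apply: invQ (ryw) Qu.
  by move/forallP/(_ w): admf; rewrite Bw fw.
have Rst x y : R x -> st f x y -> R y.
  case/existsP=> u /and3P[Qu u2 ux] xy; apply/existsP; exists u.
  by rewrite Qu u2 (clos _ _ _ ux xy).
have := fiber_closed admf Rst; rewrite big_split /=.
have : \sum_(x | R x) (1 + (#|fiber f x| == 2)) <= \sum_(x | R x) #|fiber f x|.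
  apply: leq_sum => x /existsP[u /and3P[Qu /eqP u2 ux]].
  have [/eqP->//|x2] := boolP (#|fiber f x| == 2).
  have ne : u != x by apply: contraNneq x2 => <-; rewrite u2.
  have := min2 _ _ ux ne; rewrite u2; have := leA _ u2.
  by case: (A u); case: (A x); lia.
rewrite big_split /= !sum_nat_const.
have -> : \sum_(x | R x) (#|fiber f x| == 2) = #|[set u | Q u & #|fiber f u| == 2]|.
  rewrite -sum1dep_card big_mkcond [RHS]big_mkcond /=; apply: eq_bigr => x _.
  case: ifP => [/RQ->|/negbT/negP nR]; first by case: eqP.
  by case: ifP => // /andP[Qx x2]; case: nR; apply/existsP; exists x; rewrite Qx x2 /=.
have : \sum_(x | R x) A x <= #|[set u | Q u & A u]|.
  rewrite -sum1dep_card big_mkcond [X in _ <= X]big_mkcond /=; apply: leq_sum => x _.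
  by case: ifP => [/RQ->|_]; case: (A x).
set a := \sum_(i | _) A i; set S := \sum_(i | _) #|_|; set n := #|R|; set m := #|_|; set D := #|_|.
nia.
Qed.
End Cover.

(** * Trail decompositions of bipartite graphs *)

Lemma perm_mem2 (T : eqType) (D : seq T) t1 t2 : t1 \in D -> t2 \in D -> t1 != t2 ->
  exists D0, perm_eq D (t1 :: t2 :: D0).
Proof.
move=> D1 D2 t12; have D1p := perm_to_rem D1; exists (rem t2 (rem t1 D)).
apply: perm_trans (D1p) _; rewrite perm_cons perm_to_rem //.
by move: D2; rewrite (perm_mem D1p) inE eq_sym (negPf t12).
Qed.

Section Trails.
Variables (T : finType) (h : rel T) (s tok : pred T).
Hypothesis hU : forall u w, h u w -> s u && ~~ s w.

Definition sym_rel := [rel x y | h x y || h y x].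
(** The end in [s] comes first whichever way a trail runs, so that edge lists can be compared with
    the pairs of [h]. *)
Definition orient x y := if s x then (x, y) else (y, x) : T * T.
Definition trail_edges (t : T * seq T) := pairmap orient t.1 t.2.
Definition trail_end (t : T * seq T) := last t.1 t.2.
Definition is_trail (t : T * seq T) := (t.2 != [::]) && path sym_rel t.1 t.2.
Definition rev_trail (t : T * seq T) := (trail_end t, rev (belast t.1 t.2)).
Definition ends (t : T * seq T) := [:: t.1; trail_end t].

Lemma hs_side x y : sym_rel x y -> s y = ~~ s x.
Proof. by case/orP=> /hU /andP[]; [move=> -> /negPf-> | move=> -> /negPf->]. Qed.

Lemma hs_sym x y : sym_rel x y = sym_rel y x.
Proof. by rewrite /= orbC. Qed.

Lemma ed_sym x y : sym_rel x y -> orient y x = orient x y.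
Proof. by move/hs_side=> sy; rewrite /orient sy; case: (s x). Qed.

Lemma lst_rv t : trail_end (rev_trail t) = t.1.
Proof. by case: t => x [|y p] //=; rewrite /trail_end /= rev_cons last_rcons. Qed.

Lemma okt_rv t : is_trail t -> is_trail (rev_trail t).
Proof.
case: t => x p /andP[/= p0 xp]; rewrite /is_trail /= -size_eq0 size_rev size_belast size_eq0 p0.
by rewrite /trail_end /= rev_path; rewrite (eq_path (e' := sym_rel)) // => a b; exact: hs_sym.
Qed.

Lemma eds_rv t : is_trail t -> perm_eq (trail_edges (rev_trail t)) (trail_edges t).
Proof.
case: t => x p /andP[_ /= xp]; rewrite /trail_edges /= /trail_end /=.
suff -> : pairmap orient (last x p) (rev (belast x p)) = rev (pairmap orient x p) by rewrite perm_rev.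
elim: p x xp => //= y q IH x /andP[xy yq].
rewrite !rev_cons -IH // -cats1 pairmap_cat cats1 /=; congr rcons.
have -> : last (last y q) (rev (belast y q)) = y by case: (q) => //= z l; rewrite rev_cons last_rcons.
exact: ed_sym.
Qed.

Lemma ends_rv t : perm_eq (ends (rev_trail t)) (ends t).
Proof. by rewrite /ends lst_rv /= perm_sym (perm_catC [:: _] [:: _]). Qed.

Lemma path_last_neq x p : path sym_rel x p -> s (last x p) = odd (size p) (+) s x.
Proof.
elim: p x => //= y p IH x /andP[/hs_side sy /IH ->]; rewrite sy.
by case: odd; case: s.
Qed.

Definition edge_seq := enum [pred p : T * T | h p.1 p.2].
Definition all_edges D := flatten (map trail_edges D).
Definition decomposition D := all is_trail D && perm_eq (all_edges D) edge_seq.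

(* Joining two trails, inserting a closed trail into another one and re-splicing a trail
   with ends off [s] at an end of a trail with ends in [s] all lower the total weight; so
   does moving the base of a closed trail from [tok] to a vertex of [s] outside [tok]. *)
Definition weight t :=
  if t.1 == trail_end t then (if s t.1 then (if tok t.1 then 12 else 11) else 13)
  else if s t.1 == s (trail_end t) then 11 else 10.
Definition total_weight D := sumn (map weight D).

(** Two trails weigh at least 20 and one at most 13: merging two trails lowers the total whatever
    their ends are. *)
Lemma wt_bounds t : 10 <= weight t /\ weight t <= 13.
Proof. apply/andP. by rewrite /weight; do ! case: ifP. Qed.

Lemma tedges_perm D D' : perm_eq D D' -> perm_eq (all_edges D) (all_edges D').
Proof. by move=> DD; apply: perm_flatten; apply: perm_map. Qed.

Lemma edge_decomposition : decomposition (map (fun p => (p.1, [:: p.2])) edge_seq).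
Proof.
apply/andP; split.
  by apply/allP=> t /mapP[[u w]]; rewrite mem_enum inE /= => huw ->; rewrite /is_trail /= huw.
rewrite /all_edges -map_comp (_ : flatten _ = edge_seq) //.
have : all [pred p | s p.1] edge_seq.
  by apply/allP=> p; rewrite mem_enum !inE => /hU /andP[].
elim: edge_seq => //= -[u w] l IH /= /andP[su /IH ->].
by rewrite /trail_edges /= /orient su.
Qed.

Lemma min_decomposition : exists2 D, decomposition D & forall D', decomposition D' -> total_weight D <= total_weight D'.
Proof.
suff: forall n D, decomposition D -> total_weight D < n -> exists2 D, decomposition D & forall D', decomposition D' -> total_weight D <= total_weight D'.
  by move/(_ _ _ edge_decomposition (ltnSn _)).
elim=> // n IH D decD Dn.
case: (classic (exists2 D', decomposition D' & total_weight D' < total_weight D)) => [[D' dD' lt]|no].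
  by apply: (IH D') => //; apply: leq_trans lt _.
by exists D => // D' dD'; rewrite leqNgt; apply/negP=> lt; apply: no; exists D'.
Qed.

Section Minimal.
Variable D : seq (T * seq T).
Hypothesis decD : decomposition D.
Hypothesis minD : forall D', decomposition D' -> total_weight D <= total_weight D'.

Lemma min_is_trail t : t \in D -> is_trail t.
Proof. by case/andP: decD => /allP ok _ /ok. Qed.

Lemma min_replace X Y D0 : perm_eq D (X ++ D0) -> all is_trail Y ->
  perm_eq (all_edges Y) (all_edges X) -> total_weight X <= total_weight Y.
Proof.
move=> DX okY YX; have /andP[okA pD] := decD.
have : total_weight D <= total_weight (Y ++ D0).
  apply: minD; rewrite /decomposition all_cat okY /=.
  move: okA; rewrite (perm_all _ DX) all_cat => /andP[_ ->] /=.
  apply: perm_trans pD; rewrite perm_sym; apply: perm_trans (tedges_perm DX) _.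
  by rewrite /all_edges !map_cat !flatten_cat perm_cat2r perm_sym.
rewrite /total_weight (perm_sumn (perm_map weight DX)) !map_cat !sumn_cat leq_add2r //.
Qed.

Lemma okt_cat x p q : is_trail (x, p) -> is_trail (last x p, q) -> is_trail (x, p ++ q).
Proof.
case/andP=> /= p0 xp /andP[/= _ pq]; rewrite /is_trail /= cat_path xp pq andbT.
by case: (p) p0.
Qed.

Lemma tedges1 t : all_edges [:: t] = trail_edges t.
Proof. by rewrite /all_edges /= cats0. Qed.

Lemma tedges2 t t' : all_edges [:: t; t'] = trail_edges t ++ trail_edges t'.
Proof. by rewrite /all_edges /= cats0. Qed.

Lemma eds_cat x p q : trail_edges (x, p ++ q) = trail_edges (x, p) ++ trail_edges (last x p, q).
Proof. by rewrite /trail_edges /= pairmap_cat. Qed.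

Lemma no_join t1 t2 t1' t2' D0 : perm_eq D (t1 :: t2 :: D0) ->
  t1' \in [:: t1; rev_trail t1] -> t2' \in [:: t2; rev_trail t2] -> trail_end t1' <> t2'.1.
Proof.
move=> pD i1 i2 e12.
have [ok1 ok2] : is_trail t1 /\ is_trail t2.
  by split; apply: min_is_trail; rewrite (perm_mem pD) !inE eqxx ?orbT.
have [ok1' E1] : is_trail t1' /\ perm_eq (trail_edges t1') (trail_edges t1).
  by move: i1; rewrite !inE => /orP[/eqP->|/eqP->] //; split; [exact: okt_rv | exact: eds_rv].
have [ok2' E2] : is_trail t2' /\ perm_eq (trail_edges t2') (trail_edges t2).
  by move: i2; rewrite !inE => /orP[/eqP->|/eqP->] //; split; [exact: okt_rv | exact: eds_rv].
clear i1 i2; case: t1' ok1' E1 e12 => x p ok1' E1 e12; case: t2' ok2' E2 e12 => y q ok2' E2; rewrite /trail_end /= => e12; subst y.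
have := @min_replace [:: t1; t2] [:: (x, p ++ q)] D0 pD.
rewrite /= andbT okt_cat // => /(_ isT); rewrite tedges1 tedges2 eds_cat.
rewrite perm_cat // => /(_ isT).
rewrite /total_weight /= !addn0; have := wt_bounds t1; have := wt_bounds t2.
by have := wt_bounds (x, p ++ q); move: (weight t1) (weight t2) (weight _) => a b c; lia.
Qed.

Lemma ends_disjoint t1 t2 D0 v : perm_eq D (t1 :: t2 :: D0) ->
  v \in ends t1 -> v \in ends t2 -> False.
Proof.
move=> pD; rewrite !inE => /orP[]/eqP-> /orP[]/eqP e.
- by apply: (no_join pD (t1' := rev_trail t1) (t2' := t2)); rewrite ?inE ?eqxx ?orbT // lst_rv.
- by apply: (no_join pD (t1' := rev_trail t1) (t2' := rev_trail t2)); rewrite ?inE ?eqxx ?orbT // lst_rv.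
- by apply: (no_join pD (t1' := t1) (t2' := t2)); rewrite ?inE ?eqxx ?orbT.
- by apply: (no_join pD (t1' := t1) (t2' := rev_trail t2)); rewrite ?inE ?eqxx ?orbT.
Qed.

Definition closed_trail (t : T * seq T) := t.1 == trail_end t.

Lemma split_trail (t : T * seq T) v : v \in t.1 :: t.2 -> exists p1 p2, t.2 = p1 ++ p2 /\ last t.1 p1 = v.
Proof. by case: t => x p /= /splitPl[p1 p2 <-]; exists p1, p2. Qed.

Lemma rotate t v : is_trail t -> closed_trail t -> v \in t.1 :: t.2 ->
  exists c, [/\ is_trail (v, c), last v c = v & perm_eq (trail_edges (v, c)) (trail_edges t)].
Proof.
case: t => x p /andP[/= p0 xp] /eqP; rewrite /trail_end /= => cl.
move/(split_trail (t := (x, p))) => /= [p1 [p2 [pE v1]]]; exists (p2 ++ p1).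
move: cl xp p0; rewrite pE last_cat v1 cat_path v1 => cl /andP[xp1 vp2] p0.
split.
- rewrite /is_trail /= cat_path vp2 -cl xp1 andbT.
  by move: p0; case: (p1); case: (p2).
- by rewrite last_cat -cl v1.
- by rewrite /trail_edges /= !pairmap_cat v1 -cl perm_catC.
Qed.

Lemma closed_isolated t1 t2 D0 v : perm_eq D (t1 :: t2 :: D0) -> closed_trail t1 ->
  v \in t1.1 :: t1.2 -> v \in t2.1 :: t2.2 -> False.
Proof.
move=> pD cl v1 v2.
have [ok1 ok2] : is_trail t1 /\ is_trail t2.
  by split; apply: min_is_trail; rewrite (perm_mem pD) !inE eqxx ?orbT.
have [c [okc lc pc]] := rotate ok1 cl v1.
case/split_trail: v2 => p1 [p2 [pE lp1]].
case: t2 pD ok2 pE lp1 => x p pD ok2 /= pE lp1; subst p.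
have := @min_replace [:: t1; (x, p1 ++ p2)] [:: (x, p1 ++ c ++ p2)] D0 pD.
move: okc ok2 => /andP[/= c0 pthc] /andP[/= p0 xp].
rewrite /is_trail /= andbT cat_path lp1 cat_path pthc lc.
move: xp; rewrite cat_path lp1 => /andP[-> ->] /=.
have -> : p1 ++ c ++ p2 != [::] by case: (p1) c0 => //; case: (c).
move=> /(_ isT); rewrite tedges1 tedges2 !eds_cat lp1 lc.
rewrite perm_catCA perm_cat2r pc => /(_ isT).
have -> : total_weight [:: (x, p1 ++ c ++ p2)] = total_weight [:: (x, p1 ++ p2)].
  by rewrite /total_weight /weight /trail_end /= !last_cat lp1 lc.
by rewrite /total_weight /= !addn0; have := wt_bounds t1; move: (weight t1) (weight _) => a b; lia.
Qed.

(** Rotation is free, so a base in [tok] survives only if every vertex of [s] on the trail is in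
    [tok]. This later bounds the excess by the degrees of the tokens. *)
Lemma closed_base t v : t \in D -> closed_trail t -> v \in t.1 :: t.2 ->
  s v -> s t.1 /\ (tok t.1 -> tok v).
Proof.
move=> tD cl vt sv; have [c [okc lc pc]] := rotate (min_is_trail tD) cl vt.
have := @min_replace [:: t] [:: (v, c)] (rem t D) (perm_to_rem tD).
rewrite /= okc => /(_ isT); rewrite !tedges1 => /(_ pc).
rewrite /total_weight /= !addn0 /weight /trail_end /= lc eqxx -/(trail_end t) (eqP cl : t.1 = trail_end t) eqxx sv.
by case: (s (trail_end t)); case: (tok (trail_end t)); case: (tok v).
Qed.

Lemma closed_s t : t \in D -> closed_trail t -> s t.1.
Proof.
move=> tD cl; have /andP[] := min_is_trail tD; case: t tD cl => x [|y p] //= tD cl _ /andP[xy _].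
have [//|nsx] := boolP (s x).
have sy : s y by rewrite (hs_side xy) nsx.
have yt : y \in (x, y :: p).1 :: (x, y :: p).2 by rewrite /= !inE eqxx orbT.
by case: (closed_base tD cl yt sy) => /= sx; rewrite sx in nsx.
Qed.

Lemma no_crossing t1 t2 v : t1 \in D -> t2 \in D -> ~~ s t1.1 -> ~~ s (trail_end t1) ->
  ~~ closed_trail t2 -> s t2.1 -> s (trail_end t2) -> v \in ends t2 -> v \in t1.1 :: t1.2 -> False.
Proof.
move=> D1 D2 w1 w1' ncl2 u2 u2' vt2 vt1.
have t12 : t1 != t2 by apply: contraNneq w1 => ->.
have [D0 pD] := perm_mem2 D1 D2 t12.
have [t [okt2 pt2 vt /andP[ut lt] ncl]] : exists t, [/\ is_trail t, perm_eq (trail_edges t) (trail_edges t2), t.1 = v, s v && s (trail_end t) & ~~ closed_trail t].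
  move: vt2; rewrite !inE => /orP[/eqP->|/eqP->].
    by exists t2; rewrite (min_is_trail D2) u2 u2'.
  exists (rev_trail t2); rewrite okt_rv ?(min_is_trail D2) // eds_rv ?(min_is_trail D2) // lst_rv u2 u2'; split=> //.
  by rewrite /closed_trail lst_rv /= eq_sym.
case/split_trail: vt1 => p1 [p2 [pE lp1]].
case: t1 D1 w1 w1' t12 pD pE lp1 => x p D1 w1 w1' t12 pD /= pE lp1; subst p.
move: (min_is_trail D1) => /andP[/= p0]; rewrite cat_path lp1 => /andP[xp1 vp2].
rewrite /= in w1; rewrite /trail_end /= last_cat lp1 in w1'.
have p10 : p1 != [::] by apply: contraTneq ut => p10; rewrite -lp1 p10.
have p20 : p2 != [::] by apply: contraNneq w1' => ->.
case: t okt2 pt2 vt lt ncl => [z q] /andP[/= q0 pq] pt2 /= zv lt ncl; subst z.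
rewrite /trail_end /= in lt.
(* Both new trails join [s] to its complement: weight 20 instead of at least 22. *)
have := @min_replace [:: (x, p1 ++ p2); t2] [:: (x, p1 ++ q); (v, p2)] D0 pD.
rewrite /is_trail /= p20 vp2 cat_path xp1 lp1 pq /= !andbT.
have -> : p1 ++ q != [::] by case: (p1) p10.
move=> /(_ isT); rewrite !tedges2 !eds_cat lp1 -!catA perm_cat2l.
rewrite perm_catC perm_cat2l pt2 => /(_ isT).
rewrite /total_weight /= !addn0 /weight /trail_end /= !last_cat lp1 (negPf w1) lt ut (negPf w1') /=.
have -> : (x == last v q) = false by apply: contraNF w1 => /eqP->.
have -> : (v == last v p2) = false by apply: contraNF w1' => /eqP<-.
rewrite -/(trail_end t2) u2 u2' -/(closed_trail t2) (negPf ncl2).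
by case: ifP.
Qed.

End Minimal.
End Trails.

(** * Labels along trails *)

Section Labels.
Variables (T : finType) (h : rel T) (s tok : pred T).
Hypothesis hU : forall u w, h u w -> s u && ~~ s w.

Local Notation hs := (sym_rel h).
Local Notation ed := (orient s).
Local Notation eds := (trail_edges s).
Local Notation okt := (is_trail h).
Local Notation tedges := (all_edges s).
Local Notation hE := (edge_seq h).
Local Notation trail := (T * seq T)%type.

Definition touch v (e : T * T) := (e.1 == v) || (e.2 == v).

(** [lam] stays arbitrary: for the constant 1 this is a degree, for [zigzag] a vertex sum. Comparing
    the two eliminates the number of inner visits. *)
Fixpoint touch_sum (lam : nat -> nat) i (F : seq (T * T)) v :=
  if F is e :: F' then touch v e * lam i + touch_sum lam i.+1 F' v else 0.

Lemma wsum_cat lam i F F' v :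
  touch_sum lam i (F ++ F') v = touch_sum lam i F v + touch_sum lam (i + size F) F' v.
Proof. by elim: F i => [|e F IH] i /=; rewrite ?addn0 // IH addnA addSnnS. Qed.

Lemma wsum_index lam i F v : uniq F ->
  \sum_(e <- F | touch v e) lam (i + index e F) = touch_sum lam i F v.
Proof.
elim: F i => [|e F IH] i /=; first by rewrite big_nil.
case/andP=> eF uF; rewrite big_cons /= eqxx addn0 -(IH i.+1 uF).
have -> : \sum_(j <- F | touch v j) lam (i + (if e == j then 0 else (index j F).+1)) =
  \sum_(j <- F | touch v j) lam (i.+1 + index j F).
  rewrite big_seq_cond [RHS]big_seq_cond; apply: eq_bigr => j /andP[jF _].
  by have [ej|_] := eqVneq e j; [rewrite ej jF in eF | rewrite addSnnS].
by case: touch; rewrite ?mul1n.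
Qed.

Definition inner (t : trail) v := count_mem v (behead (belast t.1 t.2)).

(** Trails start in [s] exactly at even indices, so the edges [j] and [j.+1] of a trail meet in [s]
    exactly when [j] is odd. *)
Definition alternates (lam : nat -> nat) pu pw j :=
  lam j + lam j.+1 = if odd j then pu else pw.

Lemma wsum_trail lam pu pw (t : trail) i v : okt t -> s t.1 = ~~ odd i ->
  (forall j, i <= j -> j.+1 < i + size t.2 -> alternates lam pu pw j) ->
  touch_sum lam i (eds t) v = (if s v then pu else pw) * inner t v +
    (t.1 == v) * lam i + (trail_end t == v) * lam (i + size t.2).-1.
Proof.
case: t => x [|y p] // /andP[_]; rewrite /trail_edges /inner /trail_end.
change ((x, y :: p).2) with (y :: p); change ((x, y :: p).1) with x.
have tE a b : hs a b -> touch v (ed a b) = (a == v) + (b == v) :> nat.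
  move=> ab; have ne : (a == v) && (b == v) = false.
    by apply/negP=> /andP[/eqP av /eqP bv]; have := hs_side hU ab; rewrite av bv; case: (s v).
  by rewrite /touch /orient; case: (s a); case: eqP ne => _; case: eqP => _.
elim: p x y i => [|z p IH] x y i.
  move=> /= /andP[xy _] _ _; by rewrite tE //= muln0 addn1 /= addn0 mulnDl.
move=> /= /andP[xy yp] sx al; rewrite tE //.
have sy : s y = ~~ odd i.+1 by rewrite (hs_side hU xy) sx.
have al' j : i.+1 <= j -> j.+1 < i.+1 + size (z :: p) -> alternates lam pu pw j.
  by move=> ij jp; apply: al; [exact: ltnW | rewrite -addSnnS].
have /= -> := IH y z i.+1 yp sy al'.
have E : y == v -> lam i + lam i.+1 = if s v then pu else pw.
  move/eqP<-; have := al i (leqnn _); rewrite !addnS !ltnS leq_addr /alternates => /(_ isT) ->.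
  by rewrite sy /= negbK.
rewrite (addnS i (size p).+1) /=; move: E.
move: (lam i) (lam i.+1) (lam _) (count_mem _ _) (x == v) (last z p == v) (if _ then _ else _).
by case: (y == v); clear => a b c d e f g /=; [move=> /(_ isT) <- | move=> _]; nia.
Qed.

Fixpoint end_sum (lam : nat -> nat) i (ts : seq trail) v :=
  if ts is t :: ts' then (t.1 == v) * lam i + (trail_end t == v) * lam (i + size t.2).-1
    + end_sum lam (i + size t.2) ts' v else 0.

Definition total_size (ts : seq trail) := sumn (map (fun t => size t.2) ts).
Definition all_ends (ts : seq trail) := flatten (map (@ends T) ts).
(** Consecutive trails need not share a vertex: if the sides agree, the parity of an edge's index
    tells from which side the trail traverses it. *)
Fixpoint sided_chain (b : bool) (ts : seq trail) :=
  if ts is t :: ts' then (s t.1 == b) && sided_chain (s (trail_end t)) ts' else true.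
Fixpoint end_side (b : bool) (ts : seq trail) := if ts is t :: ts' then end_side (s (trail_end t)) ts' else b.

Lemma tot_cat ts ts' : total_size (ts ++ ts') = total_size ts + total_size ts'.
Proof. by rewrite /total_size map_cat sumn_cat. Qed.

Lemma fends_cat ts ts' : all_ends (ts ++ ts') = all_ends ts ++ all_ends ts'.
Proof. by rewrite /all_ends map_cat flatten_cat. Qed.

Lemma tedges_cat ts ts' : tedges (ts ++ ts') = tedges ts ++ tedges ts'.
Proof. by rewrite /all_edges map_cat flatten_cat. Qed.

Lemma size_tedges ts : size (tedges ts) = total_size ts.
Proof. by elim: ts => //= t ts IH; rewrite /all_edges /= size_cat size_pairmap -/(tedges ts) IH. Qed.

Lemma chain_cat b ts ts' : sided_chain b (ts ++ ts') = sided_chain b ts && sided_chain (end_side b ts) ts'.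
Proof. by elim: ts b => //= t ts IH b; rewrite IH andbA. Qed.

Lemma endb_cat b ts ts' : end_side b (ts ++ ts') = end_side (end_side b ts) ts'.
Proof. by elim: ts b => //= t ts IH b. Qed.

Lemma es_cat lam i ts ts' v : end_sum lam i (ts ++ ts') v = end_sum lam i ts v + end_sum lam (i + total_size ts) ts' v.
Proof. by elim: ts i => [|t ts IH] i /=; rewrite ?addn0 // IH !addnA. Qed.

Lemma odd_tot b ts : all okt ts -> sided_chain b ts -> end_side b ts = odd (total_size ts) (+) b.
Proof.
elim: ts b => //= t ts IH b /andP[/andP[_ pt] okts] /andP[/eqP<- ch].
by rewrite IH // (path_last_neq hU pt) oddD -addbA addbCA addbA.
Qed.

Lemma wsum_ts lam pu pw i ts v : all okt ts -> sided_chain (~~ odd i) ts ->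
  (forall j, i <= j -> j.+1 < i + total_size ts -> alternates lam pu pw j) ->
  touch_sum lam i (tedges ts) v =
    (if s v then pu else pw) * sumn (map (inner^~ v) ts) + end_sum lam i ts v.
Proof.
elim: ts i => [|t ts IH] i /=; first by rewrite muln0.
move=> /andP[okt1 okts] /andP[/eqP st ch] al.
rewrite /all_edges /= wsum_cat -/(tedges ts) size_pairmap.
rewrite (wsum_trail (pu := pu) (pw := pw) _ okt1 st); last first.
  by move=> j ij jt; apply: al => //; apply: leq_trans jt _; rewrite addnA leq_addr.
rewrite IH //.
- by rewrite mulnDr; lia.
- case/andP: okt1 => _ pt; move: ch; rewrite [s _](path_last_neq hU pt) st oddD.
  by case: odd; case: odd.
- by move=> j ij jt; apply: al; [apply: leq_trans ij; rewrite leq_addr | rewrite addnA].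
Qed.

Lemma es_notin lam i ts v : v \notin all_ends ts -> end_sum lam i ts v = 0.
Proof.
elim: ts i => //= t ts IH i; rewrite /all_ends /= !inE !negb_or.
by case/and3P=> v1 v2 vts; rewrite IH // eq_sym (negPf v1) eq_sym (negPf v2).
Qed.

Lemma tot_cons t ts : total_size (t :: ts) = size t.2 + total_size ts.
Proof. by []. Qed.

Lemma es_le lam M i ts v : all okt ts -> (forall j, i <= j -> j < i + total_size ts -> lam j <= M) ->
  end_sum lam i ts v <= count_mem v (all_ends ts) * M.
Proof.
elim: ts i => //= t ts IH i /andP[/andP[t0 _] okts]; rewrite tot_cons => lamM.
rewrite /all_ends /= -/(all_ends ts) !mulnDl.
have {}t0 : 0 < size t.2 by case: (t.2) t0.
have l1 : lam i <= M by apply: lamM; lia.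
have l2 : lam (i + size t.2).-1 <= M by apply: lamM; lia.
rewrite -addnA !leq_add // ?leq_mul2l ?l1 ?l2 ?orbT //.
by apply: IH => // j ij jt; apply: lamM; lia.
Qed.

Lemma es_ge lam i ts v : all okt ts -> (forall j, i <= j -> j < i + total_size ts -> 0 < lam j) ->
  count_mem v (all_ends ts) <= end_sum lam i ts v.
Proof.
elim: ts i => //= t ts IH i /andP[/andP[t0 _] okts]; rewrite tot_cons => lamM.
rewrite /all_ends /= -/(all_ends ts).
have {}t0 : 0 < size t.2 by case: (t.2) t0.
have l1 : 0 < lam i by apply: lamM; lia.
have l2 : 0 < lam (i + size t.2).-1 by apply: lamM; lia.
rewrite -addnA !leq_add // ?leq_pmulr //.
by apply: IH => // j ij jt; apply: lamM; lia.
Qed.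

(* The labels [m, 1, m - 1, 2, ...]; two consecutive ones sum to [m.+1] or [m]. *)
Definition zigzag m j := if odd j then j./2.+1 else m - j./2.

Lemma zlab_alt m j : j.+1 < m -> alternates (zigzag m) m m.+1 j.
Proof.
by rewrite /alternates /zigzag /= uphalf_half; have := odd_double_half j; case: (odd j) => /=; lia.
Qed.

Lemma zlab_range m j : j < m -> 0 < zigzag m j <= m.
Proof. by rewrite /zigzag; have := odd_double_half j; case: (odd j) => /=; lia. Qed.

Lemma zlab_inj m i j : i < m -> j < m -> zigzag m i = zigzag m j -> i = j.
Proof.
rewrite /zigzag; have := odd_double_half j; have := odd_double_half i.
by case: (odd j); case: (odd i) => /=; lia.
Qed.

Lemma zlab_onto m l : 0 < l <= m -> exists2 j, j < m & zigzag m j = l.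
Proof.
move=> lm; case: (leqP l.*2 m) => lm2.
  exists l.-1.*2.+1; first by lia.
  by rewrite /zigzag /= odd_double /= uphalf_half odd_double doubleK; lia.
exists (m - l).*2; first by lia.
by rewrite /zigzag odd_double doubleK; lia.
Qed.

(** The first [L.*2] positions use up the [L] largest labels. With the token blocks in front, this
    keeps the labels at later trail ends at most [m - Lam]. *)
Lemma zlab_late m L j : L.*2 <= j -> j < m -> zigzag m j <= m - L.
Proof. by rewrite /zigzag; have := odd_double_half j; case: (odd j) => /=; lia. Qed.

End Labels.

(* [s] is the farther side.  [del] is the excess of a token over the balanced sum, and
   every other vertex of [s] stays [Lam] below the trivial bound. *)
Record bip_labeling (T : finType) (h : rel T) (s tok : pred T) (lab : T -> T -> nat)
    (del : T -> nat) (Lam : nat) : Prop := {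
  H_range : forall u w, h u w -> 0 < lab u w <= #|[pred p : T * T | h p.1 p.2]|;
  H_inj : forall u w u' w', h u w -> h u' w' -> lab u w = lab u' w' -> u = u' /\ w = w';
  H_onto : forall l, 0 < l <= #|[pred p : T * T | h p.1 p.2]| ->
    exists u w, h u w /\ lab u w = l;
  H_nontok : forall u, s u -> ~~ tok u ->
    \sum_(w | h u w) lab u w <= #|[pred w | h u w]|./2 * #|[pred p : T * T | h p.1 p.2]|
      + (#|[pred p : T * T | h p.1 p.2]| - Lam);
  H_tok : forall u, tok u ->
    \sum_(w | h u w) lab u w =
      #|[pred w | h u w]|./2 * #|[pred p : T * T | h p.1 p.2]| + del u;
  H_W : forall w, ~~ s w ->
    #|[pred u | h u w]|./2 * #|[pred p : T * T | h p.1 p.2]|.+1 + odd #|[pred u | h u w]|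
      <= \sum_(u | h u w) lab u w;
  H_Weven : forall w, ~~ s w -> ~~ odd #|[pred u | h u w]| ->
    \sum_(u | h u w) lab u w =
      #|[pred u | h u w]|./2 * #|[pred p : T * T | h p.1 p.2]|.+1;
  H_del : \sum_(u | tok u) del u <= Lam;
  H_Lam_deg : 2 * Lam <= \sum_(u | tok u) #|[pred w | h u w]|;
  H_Lam_m : 2 * Lam <= #|[pred p : T * T | h p.1 p.2]| }.

(** * Vertex sums along an arrangement of trails *)

Lemma add2_le2 a b c : a + (2 + (b + c)) <= 2 -> [/\ a = 0, b = 0 & c = 0].
Proof. by move=> ?; split; lia. Qed.

Section Layout.
Variables (T : finType) (h : rel T) (s tok : pred T).
Hypothesis hU : forall u w, h u w -> s u && ~~ s w.
Hypothesis tokE : forall u, tok u -> s u && ~~ odd #|[pred w | h u w]|.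

Local Notation okt := (is_trail h).
Local Notation tedges := (all_edges s).
Local Notation hE := (edge_seq h).
Local Notation trail := (T * seq T)%type.
Local Notation chain := (sided_chain s).
Local Notation endb := (end_side s).
Local Notation m := #|[pred p : T * T | h p.1 p.2]|.

Definition block_trails (l : seq (T * seq trail)) := flatten (map snd l).

(* A list of trails that starts and ends at the base [b.1], possibly jumping between
   vertices off [s], and otherwise has no end in [s]. *)
Record jump_block (b : T * seq trail) : Prop := {
  blk_s : s b.1;
  blk_chain : chain true b.2;
  blk_end : endb true b.2;
  blk_es : forall n i, ~~ odd i -> i + total_size b.2 <= n ->
    end_sum (zigzag n) i b.2 b.1 = n + (total_size b.2)./2;
  blk_cnt : count_mem b.1 (all_ends b.2) = 2;
  blk_only : forall x, x \in all_ends b.2 -> s x -> x = b.1 }.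

(** The blocks based at tokens come first, to use up the largest labels, and meet [s] only in
    tokens, so that their total length is bounded by the degrees of tokens. By [lay_cnt2] two trail
    ends coincide only at a base. *)
Record trail_layout (pre post : seq (T * seq trail)) (op : seq trail) : Prop := {
  lay_ok : all okt (block_trails (pre ++ post) ++ op);
  lay_perm : perm_eq (tedges (block_trails (pre ++ post) ++ op)) hE;
  lay_chain : chain true (block_trails (pre ++ post) ++ op);
  lay_block : forall b, b \in pre ++ post -> jump_block b;
  lay_pre : forall b, b \in pre -> tok b.1 /\ forall e, e \in tedges b.2 -> tok e.1;
  lay_post : forall b, b \in post -> ~~ tok b.1;
  lay_cnt : forall v, count_mem v (all_ends (block_trails (pre ++ post) ++ op)) <= 2;
  lay_cnt2 : forall v, count_mem v (all_ends (block_trails (pre ++ post) ++ op)) = 2 ->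
    v \in map fst (pre ++ post) }.

Lemma sum_touch_U F (G : T * T -> nat) u : perm_eq F hE -> s u ->
  \sum_(e <- F | touch u e) G e = \sum_(w | h u w) G (u, w).
Proof.
move=> FE su; rewrite (perm_big _ FE) /= big_enum_cond /=.
rewrite (reindex_onto (fun w => (u, w)) snd) /=; last first.
  move=> [x y] /andP[] /hU/= /andP[sx sy]; rewrite /touch /= => /orP[/eqP->//|/eqP yu].
  by rewrite yu su in sy.
by apply: eq_bigl => w; rewrite !inE /touch /= !eqxx !andbT.
Qed.

Lemma sum_touch_W F (G : T * T -> nat) w : perm_eq F hE -> ~~ s w ->
  \sum_(e <- F | touch w e) G e = \sum_(u | h u w) G (u, w).
Proof.
move=> FE sw; rewrite (perm_big _ FE) /= big_enum_cond /=.
rewrite (reindex_onto (fun u => (u, w)) fst) /=; last first.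
  move=> [x y] /andP[] /hU/= /andP[sx sy]; rewrite /touch /= => /orP[/eqP xw|/eqP->//].
  by rewrite -xw sx in sw.
by apply: eq_bigl => u; rewrite !inE /touch /= !eqxx orbT !andbT.
Qed.

Lemma es_const i ts (v : T) : end_sum (fun=> 1) i ts v = count_mem v (all_ends ts).
Proof. by elim: ts i => //= t ts IH i; rewrite IH !muln1 addnA. Qed.

Lemma size_hE : size hE = m.
Proof. by rewrite /edge_seq -cardE. Qed.

Lemma bts_cat l l' : block_trails (l ++ l') = block_trails l ++ block_trails l'.
Proof. by rewrite /block_trails map_cat flatten_cat. Qed.

Lemma bts_notin v l : (forall b, b \in l -> jump_block b) -> s v ->
  v \notin map fst l -> v \notin all_ends (block_trails l).
Proof.
move=> bl sv; elim: l bl => //= b l IH bl; rewrite inE negb_or => /andP[vb vl].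
rewrite /block_trails /= fends_cat mem_cat negb_or IH ?andbT // => [|b' b'l]; last first.
  by apply: bl; rewrite inE b'l orbT.
by apply: contra vb => vb; apply/eqP/(blk_only (bl b (mem_head _ _))).
Qed.

Lemma even_bts l : (forall b, b \in l -> jump_block b) -> all okt (block_trails l) -> ~~ odd (total_size (block_trails l)).
Proof.
elim: l => //= b l IH bl; rewrite /block_trails /= all_cat tot_cat oddD => /andP[okb okl].
have bb : jump_block b by apply: bl; rewrite mem_head.
have := odd_tot hU okb (blk_chain bb); rewrite (blk_end bb) addbT => /esym/negbTE ->.
by apply: IH => // b' b'l; apply: bl; rewrite inE b'l orbT.
Qed.

Section Spec.
Variables (pre post : seq (T * seq trail)) (op : seq trail).
Hypothesis L : trail_layout pre post op.
Let ts := block_trails (pre ++ post) ++ op.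
Let F := tedges ts.
Let lab u w := zigzag m (index (u, w) F).
(** Bases are distinct, so the sum has at most one term. *)
Let del u := \sum_(b <- pre | b.1 == u) (total_size b.2)./2.
Let Lam := (total_size (block_trails pre))./2.
Let inn (v : T) := sumn (map (fun t => inner t v) ts).

Let uF : uniq F.
Proof. by rewrite (perm_uniq (lay_perm L)) enum_uniq. Qed.

Let memF u w : ((u, w) \in F) = h u w.
Proof. by rewrite (perm_mem (lay_perm L)) mem_enum. Qed.

Let sF : size F = m.
Proof. by rewrite (perm_size (lay_perm L)) size_hE. Qed.

Let totts : total_size ts = m.
Proof. by rewrite -sF size_tedges. Qed.

Let wsum_deg v : touch_sum (fun=> 1) 0 F v = 2 * inn v + count_mem v (all_ends ts).
Proof.
rewrite (wsum_ts hU (pu := 2) (pw := 2) v (lay_ok L)) ?(lay_chain L) //.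
  by rewrite es_const; case: (s v).
by move=> j _ _; rewrite /alternates; case: odd.
Qed.

Let wsum_lab v : touch_sum (zigzag m) 0 F v =
  (if s v then m else m.+1) * inn v + end_sum (zigzag m) 0 ts v.
Proof.
rewrite (wsum_ts hU (pu := m) (pw := m.+1) v (lay_ok L)) ?(lay_chain L) //.
by move=> j _; rewrite add0n -/ts totts => jm; apply: zlab_alt.
Qed.

Let degU u : s u -> #|[pred w | h u w]| = 2 * inn u + count_mem u (all_ends ts).
Proof.
move=> su; rewrite -wsum_deg -(wsum_index _ _ _ uF) (sum_touch_U _ (lay_perm L) su).
by rewrite sum1_card.
Qed.

Let degW w : ~~ s w -> #|[pred u | h u w]| = 2 * inn w + count_mem w (all_ends ts).
Proof.
move=> su; rewrite -wsum_deg -(wsum_index _ _ _ uF) (sum_touch_W _ (lay_perm L) su).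
by rewrite sum1_card.
Qed.

Let sumU u : s u -> \sum_(w | h u w) lab u w = m * inn u + end_sum (zigzag m) 0 ts u.
Proof.
move=> su; have := wsum_lab u; rewrite su -(wsum_index _ _ _ uF) => <-.
by rewrite (sum_touch_U _ (lay_perm L) su).
Qed.

Let sumW w : ~~ s w -> \sum_(u | h u w) lab u w = m.+1 * inn w + end_sum (zigzag m) 0 ts w.
Proof.
move=> sw; have := wsum_lab w; rewrite (negPf sw) -(wsum_index _ _ _ uF) => <-.
by rewrite (sum_touch_W _ (lay_perm L) sw).
Qed.

Let ok_pre_post_op : [/\ all okt (block_trails pre), all okt (block_trails post) & all okt op].
Proof. by have := lay_ok L; rewrite bts_cat !all_cat => /andP[/andP[]]. Qed.

Let blkpre b : b \in pre -> jump_block b.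
Proof. by move=> bp; apply: (lay_block L); rewrite mem_cat bp. Qed.

Let blkpost b : b \in post -> jump_block b.
Proof. by move=> bp; apply: (lay_block L); rewrite mem_cat bp orbT. Qed.

Let LamE : Lam.*2 = total_size (block_trails pre).
Proof.
by case: ok_pre_post_op => /(even_bts blkpre)/negPf e _ _; rewrite -[RHS]odd_double_half e.
Qed.

(* A block of [2l] edges starting at an even index gives its base the two end
   labels [m - i] and [i + l], of sum [m + l]. *)
Let es_base l1 b l2 : pre ++ post = l1 ++ b :: l2 ->
  [/\ end_sum (zigzag m) 0 ts b.1 = m + (total_size b.2)./2, count_mem b.1 (all_ends ts) = 2,
      total_size (block_trails l1) + total_size b.2 <= m & forall b', b' \in l1 ++ l2 -> b'.1 != b.1].
Proof.
move=> E; have lc := lay_cnt L b.1; have tt := totts; have lo := lay_ok L.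
move: lc tt lo; rewrite /ts E bts_cat /block_trails /= -/(block_trails l1) -/(block_trails l2).
have blk b' : b' \in l1 ++ b :: l2 -> jump_block b' by rewrite -E; exact: (lay_block L).
have bb : jump_block b by apply: blk; rewrite mem_cat mem_head orbT.
rewrite -!catA !fends_cat !count_cat (blk_cnt bb) !tot_cat all_cat => lc tt /andP[ok1 _].
have [z1 z2 z3] := add2_le2 lc.
have ev : ~~ odd (total_size (block_trails l1)).
  by apply: even_bts => // b' b'l; apply: blk; rewrite mem_cat b'l.
split.
- rewrite !es_cat add0n (es_notin _ _ (introT count_memPn z1)) (es_notin _ _ (introT count_memPn z2)).
  rewrite (es_notin _ _ (introT count_memPn z3)).
  by rewrite !addn0 add0n blk_es // -tt addnA leq_addr.
- by rewrite z1 z2 z3.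
- by rewrite -tt addnA leq_addr.
- move=> b' b'l; apply/eqP=> bE.
  have b'l' : b' \in l1 ++ b :: l2 by move: b'l; rewrite !mem_cat inE => /orP[]->; rewrite ?orbT.
  have : count_mem b.1 (all_ends b'.2) = 2 by rewrite -bE; apply: blk_cnt; apply: blk.
  suff -> : count_mem b.1 (all_ends b'.2) = 0 by [].
  have cz l : b' \in l -> count_mem b.1 (all_ends (block_trails l)) = 0 -> count_mem b.1 (all_ends b'.2) = 0.
    case/splitPr=> q1 q2; rewrite bts_cat /block_trails /= !fends_cat !count_cat; lia.
  by move: b'l; rewrite mem_cat => /orP[/cz->|/cz->].
Qed.

Let es_nonbase v : s v -> v \notin map fst (pre ++ post) ->
  end_sum (zigzag m) 0 ts v <= count_mem v (all_ends ts) * (m - Lam).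
Proof.
move=> sv; rewrite map_cat mem_cat negb_or => /andP[vpre vpost].
have [ok1 ok2 ok3] := ok_pre_post_op; have tt := totts; move: tt.
rewrite /ts bts_cat -catA !es_cat !fends_cat !count_cat !tot_cat add0n => tt.
rewrite (es_notin _ _ (bts_notin blkpre sv vpre)) (es_notin _ _ (bts_notin blkpost sv vpost)).
rewrite !add0n !mulnDl -[X in X <= _]add0n leq_add // -[X in X <= _]add0n leq_add //.
apply: (es_le (h := h)) => // j jl jt; apply: zlab_late; last by rewrite -tt addnA.
by rewrite LamE (leq_trans _ jl) // leq_addr.
Qed.

Let del_nonbase v : v \notin map fst (pre ++ post) -> del v = 0.
Proof.
rewrite map_cat mem_cat negb_or => /andP[vpre _]; rewrite /del big1_seq // => b /andP[/eqP bv bp].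
by case/negP: vpre; rewrite -bv map_f.
Qed.

Let es_count0 v : count_mem v (all_ends ts) = 0 -> end_sum (zigzag m) 0 ts v = 0.
Proof. by move=> c0; apply: es_notin; apply/count_memPn. Qed.

Let cnt1 v : v \notin map fst (pre ++ post) -> count_mem v (all_ends ts) <= 1.
Proof.
move=> vn; have := lay_cnt L v; rewrite leq_eqVlt => /orP[/eqP/(lay_cnt2 L)|//].
by rewrite (negPf vn).
Qed.

Let cnt_W w : ~~ s w -> count_mem w (all_ends ts) <= 1.
Proof.
move=> sw; apply: cnt1; apply: contra sw => /mapP[b bl ->]; exact: (blk_s (lay_block L bl)).
Qed.

Let split_base v : v \in map fst (pre ++ post) ->
  exists l1 b l2, pre ++ post = l1 ++ b :: l2 /\ b.1 = v.
Proof.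
by case/mapP=> b bl ->; case/splitPr: bl => l1 l2; exists l1, b, l2.
Qed.

Lemma layout_labeling : bip_labeling h s tok lab del Lam.
Proof.
split.
- by move=> u w huw; apply: zlab_range; rewrite -sF index_mem memF.
- move=> u w u' w' huw hu'w' /zlab_inj; rewrite -sF !index_mem !memF => /(_ huw hu'w') E.
  have := nth_index (u, w) (s := F) (x := (u, w)); rewrite memF => /(_ huw).
  by rewrite E nth_index ?memF // => -[-> ->].
- move=> l /zlab_onto[j]; rewrite -sF => jF <-.
  have [[u w] _] : {p : T * T | true} by case: (F) jF => // p; exists p.
  have E : nth (u, w) F j = ((nth (u, w) F j).1, (nth (u, w) F j).2) by case: nth.
  exists (nth (u, w) F j).1, (nth (u, w) F j).2; rewrite -memF /lab -E mem_nth //.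
  by rewrite index_uniq // sF.
- move=> u su ntu; rewrite sumU // degU //.
  have [ub|ub] := boolP (u \in map fst (pre ++ post)).
    have [l1 [b [l2 [E bu]]]] := split_base ub; have [e2 e3 e4 _] := es_base E.
    move: e2 e3; rewrite bu => -> ->.
    have bpost : b \in post.
      have : b \in pre ++ post by rewrite E mem_cat mem_head orbT.
      by rewrite mem_cat => /orP[/(lay_pre L)[]|//]; rewrite bu (negPf ntu).
    (* A base outside [tok] has its block after [pre], hence of length at most [m - Lam.*2]. *)
    have : total_size b.2 + Lam.*2 <= m.
      rewrite LamE -totts /ts bts_cat !tot_cat; case/splitPr: bpost => q1 q2.
      by rewrite bts_cat /block_trails /= !tot_cat; lia.
    have -> : (2 * inn u + 2)./2 = inn u + 1 by lia.
    by rewrite mulnDl mul1n (mulnC (inn u)); lia.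
  have := es_nonbase su ub; have := cnt1 ub.
  case: (count_mem u (all_ends ts)) => [|[|//]] _; rewrite ?mul0n ?mul1n.
    by rewrite addn0 mul2n doubleK mulnC; lia.
  by rewrite addn1 mul2n /= uphalf_double mulnC; lia.
(* A token has even degree, so it is either the base of a block or no trail end at all. *)
- move=> u tu; have /andP[su] := tokE tu; rewrite sumU // degU //.
  have [ub|ub] := boolP (u \in map fst (pre ++ post)).
    have [l1 [b [l2 [E bu]]]] := split_base ub; have [e2 e3 _ e4] := es_base E.
    move: e2 e3; rewrite bu => -> -> _.
    have bpre : b \in pre.
      have : b \in pre ++ post by rewrite E mem_cat mem_head orbT.
      by rewrite mem_cat => /orP[//|/(lay_post L)]; rewrite bu tu.
    have -> : del u = (total_size b.2)./2.
      have : (forall b', b' \in post -> b'.1 != u).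
        by move=> b' /(lay_post L); apply: contraNneq => ->.
      rewrite /del; have := congr1 (fun l => \sum_(b <- l | b.1 == u) (total_size b.2)./2) E.
      rewrite !big_cat big_cons /= bu eqxx => E' npost.
      rewrite [X in _ + X = _]big1_seq in E'; last by move=> b' /andP[/eqP b'u /npost]; rewrite b'u eqxx.
      rewrite addn0 in E'; rewrite E' !big1_seq ?addn0 //.
        by move=> b' /andP[/eqP b'u b'l]; have := e4 b'; rewrite mem_cat b'l orbT b'u bu eqxx => /(_ isT).
      by move=> b' /andP[/eqP b'u b'l]; have := e4 b'; rewrite mem_cat b'l b'u bu eqxx => /(_ isT).
    have -> : (2 * inn u + 2)./2 = inn u + 1 by lia.
    by rewrite mulnDl mul1n (mulnC (inn u)); lia.
  rewrite del_nonbase //; have := cnt1 ub; have := @es_count0 u.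
  case: (count_mem u (all_ends ts)) => [|[|//]] z _; last by rewrite mul2n addn1 /= odd_double.
  by rewrite z // !addn0 mul2n doubleK mulnC.
- move=> w sw; rewrite sumW // degW //.
  have : count_mem w (all_ends ts) <= end_sum (zigzag m) 0 ts w.
    apply: (es_ge (h := h)); first exact: (lay_ok L).
    by move=> j _; rewrite add0n totts => /zlab_range/andP[].
  have := cnt_W sw; case: (count_mem w (all_ends ts)) => [|[|//]] _.
    by rewrite addn0 mul2n doubleK odd_double mulnC; lia.
  by rewrite addn1 mul2n /= uphalf_double odd_double mulnC; lia.
- move=> w sw; rewrite sumW // degW //.
  have := cnt_W sw; have := @es_count0 w; case: (count_mem w (all_ends ts)) => [|[|//]] z _.
    by rewrite z // !addn0 mul2n doubleK mulnC.
  by rewrite addn1 mul2n /= odd_double.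
- rewrite /del (exchange_big_dep xpredT) //= /Lam.
  have ev := blkpre; have [ok _ _] := ok_pre_post_op.
  elim: (pre) ev ok => [|b l IH] bl; first by rewrite big_nil.
  rewrite /block_trails /= all_cat big_cons tot_cat => /andP[okb okl].
  have bb : jump_block b by apply: bl; rewrite mem_head.
  have := odd_tot hU okb (blk_chain bb); rewrite (blk_end bb) addbT => /esym/negbTE ob.
  rewrite halfD ob /= add0n leq_add //; last first.
    by apply: IH => // b' b'l; apply: bl; rewrite inE b'l orbT.
  apply: (@leq_trans (\sum_(u | u == b.1) (total_size b.2)./2)); last by rewrite big_pred1_eq.
  rewrite big_mkcond [X in _ <= X]big_mkcond /=; apply: leq_sum => u _.
  by rewrite eq_sym; case: (tok u); case: eqP.
(* [2 * Lam] counts the edges of the blocks in [pre], each of which has its end in [s] at a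
   token. *)
- rewrite mul2n LamE -(size_tedges s).
  have -> : \sum_(u | tok u) #|[pred w | h u w]| =
      \sum_(p : T * T | tok p.1 && h p.1 p.2) 1.
    by rewrite -(pair_big_dep _ _ (fun _ _ => 1)); apply: eq_bigr => u _; rewrite sum1_card.
  have -> : \sum_(p : T * T | tok p.1 && h p.1 p.2) 1 = \sum_(e <- F | tok e.1) 1.
    rewrite (perm_big _ (lay_perm L)) big_enum_cond /=.
    by apply: eq_bigl => p; rewrite inE andbC.
  rewrite /F /ts bts_cat !tedges_cat !big_cat /= -addnA -[X in X <= _]addn0 leq_add //.
  rewrite -sum1_size big_seq_cond [X in _ <= X]big_seq_cond.
  rewrite eq_leq //; apply: eq_bigl => e /=; case ei: (e \in _) => //=; symmetry.
  have [b bp eb] : exists2 b, b \in pre & e \in tedges b.2.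
    elim: (pre) ei => //= b l IH; rewrite /block_trails /= tedges_cat mem_cat.
    case/orP=> [eb|/IH[b' b'l eb']]; first by exists b; rewrite ?mem_head.
    by exists b'; rewrite // inE b'l orbT.
  by case: (lay_pre L bp) => _; apply.
- by rewrite mul2n LamE -totts /ts bts_cat !tot_cat -addnA leq_addr.
Qed.
End Spec.
End Layout.

(** The labels are [n - i./2] and [(i + l)./2]: the position of an even segment cancels and only its
    length counts. *)
Lemma zlab_sum n i l : ~~ odd i -> ~~ odd l -> 0 < l -> i + l <= n ->
  zigzag n i + zigzag n (i + l).-1 = n + l./2.
Proof.
move=> oi ol l0 iln; rewrite /zigzag (negPf oi).
have -> : odd (i + l).-1 by lia.
by lia.
Qed.

(** * Arranging a minimal trail decomposition *)

Section Existence.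
Variables (T : finType) (h : rel T) (s tok : pred T).
Hypothesis hU : forall u w, h u w -> s u && ~~ s w.

Local Notation okt := (is_trail h).
Local Notation eds := (trail_edges s).
Local Notation tedges := (all_edges s).
Local Notation hE := (edge_seq h).
Local Notation trail := (T * seq T)%type.
Local Notation chain := (sided_chain s).
Local Notation endb := (end_side s).
Local Notation block := (jump_block s).
Local Notation layout := (trail_layout h s tok).

Lemma mem_eds (t : trail) e : okt t -> e \in eds t -> (e.1 \in t.1 :: t.2) && s e.1.
Proof.
case: t => x p /andP[_ /=]; rewrite /trail_edges /=.
elim: p x => //= y p IH x /andP[xy yp]; rewrite inE => /orP[/eqP->|/(IH _ yp)].
  have := hs_side hU xy; rewrite /orient; case sx: (s x) => /= sy.
    by rewrite mem_head sx.
  by rewrite !inE eqxx orbT sy.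
by case/andP=> ein ->; rewrite in_cons ein orbT.
Qed.

Fixpoint alt (b : bool) (l : seq trail) :=
  if l is t :: l' then (if s t.1 == b then t else rev_trail t) :: alt (~~ b) l' else [::].

Lemma alt_spec b l : all okt l -> all (fun t => s t.1 != s (trail_end t)) l ->
  [/\ all okt (alt b l), perm_eq (tedges (alt b l)) (tedges l),
      perm_eq (all_ends (alt b l)) (all_ends l) & chain b (alt b l)].
Proof.
elim: l b => //= t l IH b /andP[okt1 okl] /andP[tx lx].
have [IH1 IH2 IH3 IH4] := IH (~~ b) okl lx.
case: eqP => [tb|/eqP tb].
  rewrite /= okt1 IH1 /all_edges /all_ends /= perm_cat2l !perm_cons tb eqxx /=; split=> //.
  by have -> : s (trail_end t) = ~~ b by move: tx; rewrite tb; move: (s _); clear; case: b => -[].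
rewrite /= okt_rv // IH1 lst_rv; split=> //.
- by rewrite /all_edges /=; apply: perm_cat; [exact: eds_rv okt1 | exact: IH2].
- exact: (perm_cat (ends_rv t) IH3).
- have -> : s t.1 = ~~ b by move: tb; move: (s _); clear; case: b => -[].
  have -> : s (trail_end t) = b by move: tx tb; move: (s t.1) (s (trail_end t)); clear; case: b => -[] -[].
  by rewrite eqxx.
Qed.

Lemma chain_all b (l : seq trail) : all (fun t => (s t.1 == b) && (s (trail_end t) == b)) l ->
  chain b l /\ endb b l = b.
Proof.
elim: l => //= t l IH /andP[/andP[-> /eqP->] /IH[-> ->]]; by [].
Qed.

Lemma blocks_chain l : (forall b, b \in l -> block b) -> chain true (block_trails l) /\ endb true (block_trails l).
Proof.
elim: l => //= b l IH bl; rewrite /block_trails /= chain_cat endb_cat.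
have bb : block b by apply: bl; rewrite mem_head.
rewrite (blk_chain bb) (blk_end bb); apply: IH => b' b'l; apply: bl; rewrite inE b'l orbT //.
Qed.

Section Min.
Variable D : seq trail.
Hypothesis decD : decomposition h s D.
Hypothesis minD : forall D', decomposition h s D' -> total_weight s tok D <= total_weight s tok D'.

Let Kc := [seq t <- D | closed_trail t && tok t.1].
Let Cc := [seq t <- D | closed_trail t && ~~ tok t.1].
Let UU := [seq t <- D | [&& ~~ closed_trail t, s t.1 & s (trail_end t)]].
Let WW := [seq t <- D | [&& ~~ closed_trail t, ~~ s t.1 & ~~ s (trail_end t)]].
Let XX := [seq t <- D | ~~ closed_trail t && (s t.1 != s (trail_end t))].
Let mkb (t : trail) : T * seq trail := (t.1, [:: t]).

Lemma perm_classes : perm_eq D (Kc ++ Cc ++ UU ++ WW ++ XX).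
Proof.
apply/permP=> a; rewrite !count_cat /Kc /Cc /UU /WW /XX !count_filter.
elim: D => //= t l ->; case: (a t); case: (closed_trail t); case: (tok t.1); case: (s t.1); case: (s (trail_end t)) => /=; lia.
Qed.

Let okDt t : t \in D -> okt t. Proof. by move=> tD; apply: (min_is_trail decD tD). Qed.

Lemma fends_perm (l l' : seq trail) : perm_eq l l' -> perm_eq (all_ends l) (all_ends l').
Proof. by move=> ll; apply: perm_flatten; apply: perm_map. Qed.

Lemma count_ends t v : t \in D -> v \in ends t ->
  count_mem v (all_ends D) = count_mem v (ends t).
Proof.
move=> tD vt; rewrite (permP (fends_perm (perm_to_rem tD))) /all_ends /= -/(all_ends _).
suff -> : count_mem v (all_ends (rem t D)) = 0 by rewrite !addn0.
apply/count_memPn/negP=> /flatten_mapP[t' t'D vt'].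
apply: (ends_disjoint hU decD minD (t1 := t) (t2 := t') (D0 := rem t' (rem t D))) vt vt'.
by apply: perm_trans (perm_to_rem tD) _; rewrite perm_cons perm_to_rem.
Qed.

Lemma count_ends_le v : count_mem v (all_ends D) <= 2.
Proof.
have [/flatten_mapP[t tD vt]|/count_memPn->//] := boolP (v \in all_ends D).
by rewrite (count_ends tD vt) /=; case: eqP; case: eqP.
Qed.

Lemma count_ends2 v : count_mem v (all_ends D) = 2 -> exists t, [/\ t \in D, closed_trail t & t.1 = v].
Proof.
have [/flatten_mapP[t tD vt]|/count_memPn->//] := boolP (v \in all_ends D).
rewrite (count_ends tD vt) /= addn0; case: eqP => // tv; case: eqP => // lv _.
by exists t; rewrite /closed_trail tv lv.
Qed.

Lemma bts_mkb l : block_trails (map mkb l) = l.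
Proof. by rewrite /block_trails -map_comp; elim: l => //= t l ->. Qed.

Lemma block_closed t : t \in D -> closed_trail t -> block (mkb t).
Proof.
move=> tD cl; have st := closed_s hU decD minD tD cl.
have /andP[t0 pt] := okDt tD; have tl := eqP cl.
split=> //=.
- by rewrite st.
- by rewrite -tl.
- move=> n i oi; rewrite /total_size /= addn0 => iln; rewrite -tl eqxx !mul1n addn0; apply: zlab_sum => //.
    by have := path_last_neq hU pt; rewrite -/(trail_end t) -tl st addbT => /esym/negbTE->.
  by case: (t.2) t0.
- by rewrite -tl eqxx.
- by move=> x; rewrite /all_ends /= !inE -tl orbb => /eqP.
Qed.

(** Besides the closed trails at most one further block will be needed; it goes into [gp] if its
    base is a token and into [gq] otherwise. *)
Lemma layout_of_blocks gp gq op : all okt (block_trails (gp ++ gq) ++ op) ->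
  perm_eq (tedges (block_trails (gp ++ gq) ++ op)) (tedges (UU ++ WW ++ XX)) ->
  chain true op -> (forall b, b \in gp ++ gq -> block b) ->
  (forall b, b \in gp -> tok b.1 /\ forall e, e \in tedges b.2 -> tok e.1) ->
  (forall b, b \in gq -> ~~ tok b.1) ->
  (forall v, count_mem v (all_ends (block_trails (gp ++ gq) ++ op)) =
     count_mem v (all_ends (UU ++ WW ++ XX)) + 2 * (v \in map fst (gp ++ gq))) ->
  (forall v, v \in map fst (gp ++ gq) -> v \notin all_ends D) ->
  layout (map mkb Kc ++ gp) (gq ++ map mkb Cc) op.
Proof.
move=> ok pm ch bl blp blq cnt nD.
have E : (map mkb Kc ++ gp) ++ gq ++ map mkb Cc = map mkb Kc ++ (gp ++ gq) ++ map mkb Cc.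
  by rewrite -!catA.
have Ebts : block_trails (map mkb Kc ++ (gp ++ gq) ++ map mkb Cc) ++ op = Kc ++ block_trails (gp ++ gq) ++ Cc ++ op.
  by rewrite !bts_cat !bts_mkb -!catA.
have KCD t : t \in Kc ++ Cc -> t \in D /\ closed_trail t.
  by rewrite mem_cat !mem_filter => /orP[]/andP[/andP[]].
have blk b : b \in map mkb Kc ++ (gp ++ gq) ++ map mkb Cc -> block b.
  rewrite !mem_cat => /or3P[/mapP[t tK ->]|bg|/mapP[t tC ->]].
  - by case: (KCD t) => [|tD cl]; [rewrite mem_cat tK | exact: block_closed].
  - by apply: bl; rewrite mem_cat.
  - by case: (KCD t) => [|tD cl]; [rewrite mem_cat tC orbT | exact: block_closed].
have cntD v : count_mem v (all_ends (Kc ++ block_trails (gp ++ gq) ++ Cc ++ op)) =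
    count_mem v (all_ends D) + 2 * (v \in map fst (gp ++ gq)).
  rewrite (permP (fends_perm perm_classes)); have := cnt v.
  by rewrite !fends_cat !count_cat; lia.
split; rewrite ?E ?Ebts.
- have okl l : {subset l <= D} -> all okt l by move=> lD; apply/allP=> t /lD/okDt.
  move: ok; rewrite !all_cat => /andP[-> ->] /=.
  by rewrite !okl // => t; rewrite mem_filter => /andP[].
- case/andP: decD => _; apply: perm_trans; rewrite perm_sym.
  apply: perm_trans (tedges_perm _ perm_classes) _.
  rewrite !(tedges_cat _ Kc) perm_cat2l perm_sym.
  rewrite perm_sym tedges_cat perm_sym (tedges_cat _ (block_trails _)) (tedges_cat _ Cc).
  rewrite perm_catCA perm_cat2l -tedges_cat //.
- have [c1 c2] := blocks_chain blk.
  by rewrite -Ebts chain_cat c1 c2.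
- exact: blk.
- move=> b; rewrite mem_cat => /orP[/mapP[t tK ->]|]; last exact: blp.
  move: (tK); rewrite mem_filter => /andP[/andP[cl tk] tD]; split=> // e.
  rewrite tedges1 => /(mem_eds (okDt tD))/andP[et se].
  by have [_] := closed_base decD minD tD cl et se; apply.
- move=> b; rewrite mem_cat => /orP[|/mapP[t tK ->]]; first exact: blq.
  by move: tK; rewrite mem_filter => /andP[/andP[]].
- move=> v; rewrite cntD; have [vg|_] := boolP (v \in _); last by rewrite addn0 count_ends_le.
  by rewrite (count_memPn (nD v vg)).
- move=> v; rewrite cntD; have [vg _|_] := boolP (v \in map fst (gp ++ gq)).
    by rewrite !map_cat !mem_cat in vg *; rewrite vg orbT.
  rewrite addn0 => /count_ends2[t [tD cl tv]].
  have : t \in Kc ++ Cc by rewrite mem_cat !mem_filter cl tD; case: (tok _).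
  rewrite !map_cat !mem_cat -tv => /orP[tK|tC].
    by rewrite (map_f fst (map_f mkb tK)).
  by rewrite (map_f fst (map_f mkb tC)) !orbT.
Qed.

(* If no trail has exactly one end in [s], the trails with both ends off [s] are chained
   into one block by cutting one of them at an inner vertex of [s]. *)
Lemma cut_block t v : t \in WW -> v \in t.2 -> s v -> XX = [::] ->
  exists b : T * seq trail, [/\ block b, b.1 = v, v \notin all_ends D,
    all okt b.2 & perm_eq (tedges b.2) (tedges WW) /\
    forall y, count_mem y (all_ends b.2) = count_mem y (all_ends WW) + 2 * (y == v)].
Proof.
move=> tW vt sv X0.
move: (tW); rewrite mem_filter => /andP[/and3P[ncl st sl] tD].
have pW := perm_to_rem tW; set WW' := rem t WW in pW.
have WWs t' : t' \in WW -> [/\ ~~ s t'.1, ~~ s (trail_end t') & t' \in D].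
  by rewrite mem_filter => /andP[/and3P[_ -> ->] ->].
have W's t' : t' \in WW' -> [/\ ~~ s t'.1, ~~ s (trail_end t') & t' \in D].
  by move/mem_rem; exact: WWs.
(* A trail ending at [v] would meet [t] there. If closed, it contradicts [closed_isolated];
   otherwise both its ends are in [s], as [XX] is empty, and [no_crossing] applies. *)
have nD : v \notin all_ends D.
  apply/negP=> /flatten_mapP[t' t'D vt'].
  have vt1 : v \in t.1 :: t.2 by rewrite inE vt orbT.
  have tt' : t' != t.
    by apply/eqP=> E; move: vt'; rewrite E !inE => /orP[]/eqP E'; move: sv; rewrite E' ?(negPf st) ?(negPf sl).
  have [D0 pD] := perm_mem2 t'D tD tt'.
  have [cl|ncl'] := boolP (closed_trail t').
    apply: (closed_isolated decD minD pD cl (v := v)) vt1.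
    move: vt'; rewrite !inE => /orP[->//|/eqP->].
    by rewrite -(eqP cl) eqxx.
  have [sx|nsx] := eqVneq (s t'.1) (s (trail_end t')).
    have st' : s t'.1 by move: vt'; rewrite !inE => /orP[]/eqP E; [rewrite -E | rewrite sx -E].
    by apply: (no_crossing hU decD minD tD t'D st sl ncl' st' _ vt' vt1); rewrite -sx.
  have : t' \in XX by rewrite mem_filter ncl' nsx.
  by rewrite X0.
have [p1 [p2 [pE lp1]]] : exists p1 p2, t.2 = p1 ++ p2 /\ last t.1 p1 = v.
  by apply: split_trail; rewrite inE vt orbT.
have /andP[t0] := okDt tD; rewrite pE cat_path lp1 => /andP[pp1 pp2].
have p10 : p1 != [::] by apply: contraNneq st => p10; move: lp1; rewrite p10 /= => ->.
have lp2 : last v p2 = trail_end t by rewrite /trail_end pE last_cat lp1.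
have p20 : p2 != [::] by apply: contraNneq sl => p20; rewrite -lp2 p20.
(* From the cut at [v] along the second half of [t], through the other trails of [WW], and back to
   [v] along the first half. *)
pose L := (v, p2) :: WW' ++ [:: (t.1, p1)].
have okL : all okt L.
  rewrite /L /= all_cat /= /is_trail /= p10 p20 pp1 pp2 !andbT.
  by apply/allP=> t' /W's[_ _ /okDt].
have pL : perm_eq (tedges L) (tedges WW).
  rewrite perm_sym; apply: perm_trans (tedges_perm _ pW) _.
  rewrite /L -[_ :: WW']cat1s -[_ :: WW' ++ _]cat1s !tedges_cat !tedges1.
  have -> : eds t = eds (t.1, p1) ++ eds (v, p2).
    by rewrite -lp1 -eds_cat -pE; case: (t).
  by rewrite -catA perm_catC -catA.
have cL y : count_mem y (all_ends L) = count_mem y (all_ends WW) + 2 * (y == v).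
  rewrite (permP (fends_perm pW)) /L -[_ :: WW']cat1s -[_ :: WW' ++ _]cat1s !fends_cat !count_cat /all_ends /=.
  rewrite /trail_end /= lp1 lp2 (eq_sym y) !addn0 -/(trail_end t).
  move: (count_mem _ _) (nat_of_bool (t.1 == y)) (nat_of_bool (trail_end t == y)) (nat_of_bool (v == y)).
  by clear; lia.
have v0 : count_mem v (all_ends WW) = 0.
  apply/count_memPn/negP=> /flatten_mapP[t' /WWs[s1 s2 _]].
  by rewrite !inE => /orP[]/eqP E; move: sv; rewrite E ?(negPf s1) ?(negPf s2).
exists (v, L); split=> //.
have chW : chain false WW' /\ endb false WW' = false.
  by apply: chain_all; apply/allP=> t' /W's[/negPf-> /negPf-> _].
have chL : chain true L.
  by rewrite /L /= sv /= /trail_end /= lp2 (negPf sl) chain_cat chW.1 chW.2 /= (negPf st).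
have enL : endb true L.
  change (endb (s (last v p2)) (WW' ++ [:: (t.1, p1)])).
  by rewrite lp2 (negPf sl) endb_cat chW.2 /= /trail_end /= lp1.
have c2 : count_mem v (all_ends L) = 2 by rewrite cL v0 eqxx.
have onlyL x : x \in all_ends L -> s x -> x = v.
  have -> : all_ends L = [:: v; trail_end t] ++ all_ends WW' ++ [:: t.1; v].
    by rewrite /L -[_ :: WW' ++ _]cat1s !fends_cat /all_ends /= /ends /trail_end /= lp1 lp2.
  rewrite !mem_cat => /or3P[|xW|]; [|move: xW|]; rewrite ?in_cons ?in_nil ?orbF.
  - by case/orP=> /eqP-> //; rewrite (negPf sl).
  - case/flatten_mapP=> t' /W's[s1 s2 _]; rewrite !inE.
    by case/orP=> /eqP->; rewrite ?(negPf s1) ?(negPf s2).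
  - by case/orP=> /eqP-> //; rewrite (negPf st).
split=> //.
- move=> n i oi iln.
  have oL : ~~ odd (total_size L) by have := odd_tot hU okL chL; rewrite enL addbT => /esym/negbTE->.
  have L0 : 0 < total_size L by rewrite /L tot_cons; case: (p2) p20.
  rewrite -(zlab_sum oi oL L0 iln) /L /= es_cat /= /trail_end /= lp1 lp2 !eqxx.
  have -> : (trail_end t == v) = false by apply: contraNF sl => /eqP->.
  have -> : (t.1 == v) = false by apply: contraNF st => /eqP->.
  rewrite es_notin; last first.
    apply/negP=> /flatten_mapP[t' /W's[s1 s2 _]].
    by rewrite !inE => /orP[]/eqP E; move: sv; rewrite E ?(negPf s1) ?(negPf s2).
  rewrite !mul1n !mul0n !addn0 !add0n tot_cons tot_cat; congr (_ + zigzag _ _).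
  by rewrite /total_size /= addn0 !addnA.
Qed.

(** Trails of [UU] chain on the side of [s], those of [WW] on the other side. A trail of [XX]
    provides the passage between the sides; if there is none, [WW] is made into a block. *)
Lemma layout_exists : exists pre post op, layout pre post op.
Proof.
have okf (a : pred trail) : all okt (filter a D).
  by apply/allP=> t; rewrite mem_filter => /andP[_ /okDt].
have [cU eU] : chain true UU /\ endb true UU = true.
  by apply: chain_all; apply/allP=> t; rewrite mem_filter => /andP[/and3P[_ -> ->]].
have [cW eW] : chain false WW /\ endb false WW = false.
  by apply: chain_all; apply/allP=> t; rewrite mem_filter => /andP[/and3P[_ /negPf-> /negPf->]].
have sX : all (fun t => s t.1 != s (trail_end t)) XX.
  by apply/allP=> t; rewrite mem_filter => /andP[/andP[]].
have nogap op : all okt op -> perm_eq (tedges op) (tedges (UU ++ WW ++ XX)) ->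
    perm_eq (all_ends op) (all_ends (UU ++ WW ++ XX)) -> chain true op ->
    exists pre post op, layout pre post op.
  move=> o1 o2 o3 o4; exists (map mkb Kc ++ [::]), ([::] ++ map mkb Cc), op.
  by apply: layout_of_blocks => // v; rewrite (permP o3) addn0.
case EX : XX => [|x X'].
  case EW : WW => [|t W'].
    apply: (nogap UU) => //; first exact: okf.
      by rewrite EW EX /= cats0.
    by rewrite EW EX /= cats0.
  (* The cut vertex is taken outside [tok] if possible; if not, all edges of [WW] have their end in
     [s] at a token, as a block of [pre] requires. *)
  have [t' [v [tW vt sv tokv]]] : exists t' v, [/\ t' \in WW, v \in t'.2, s v &
      tok v -> forall e, e \in tedges WW -> tok e.1].
    have [/hasP[t' tW /hasP[v vt /andP[sv nv]]]|no] :=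
        boolP (has (fun t : trail => has (fun y => s y && ~~ tok y) t.2) WW).
      by exists t', v; split=> //; rewrite (negPf nv).
    have tW : t \in WW by rewrite EW mem_head.
    move: (tW); rewrite mem_filter => /andP[/and3P[_ st sl] /okDt].
    case: t EW tW st sl => x [|y p] // EW tW st sl /andP[_ /= /andP[xy _]].
    exists (x, y :: p), y; split=> //=; first by rewrite mem_head.
      by rewrite (hs_side hU xy).
    move=> _ e /flatten_mapP[t' tW' et'].
    move: (tW'); rewrite mem_filter => /andP[/and3P[_ st' sl'] /okDt ok'].
    have /andP[] := mem_eds ok' et'; rewrite inE => /orP[/eqP->|et se]; first by rewrite (negPf st').
    have /hasPn/(_ t' tW')/hasPn/(_ _ et) := no; rewrite se /= negbK //.
  have [b [blkb bv nvD okb [pb cb]]] := cut_block tW vt sv EX.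
  have tot1 (gp gq : seq (T * seq trail)) : gp ++ gq = [:: b] ->
      [/\ all okt (block_trails (gp ++ gq) ++ UU),
          perm_eq (tedges (block_trails (gp ++ gq) ++ UU)) (tedges (UU ++ WW ++ XX)),
          (forall b', b' \in gp ++ gq -> block b'),
          (forall v, count_mem v (all_ends (block_trails (gp ++ gq) ++ UU)) =
            count_mem v (all_ends (UU ++ WW ++ XX)) + 2 * (v \in map fst (gp ++ gq))) &
          (forall v, v \in map fst (gp ++ gq) -> v \notin all_ends D)].
    move=> ->; rewrite /block_trails /= cats0 EX cats0; split.
    - by rewrite all_cat okb; exact: okf.
    - by rewrite !tedges_cat perm_catC perm_cat2l.
    - by move=> b'; rewrite inE => /eqP->.
    - by move=> y; rewrite !fends_cat !count_cat cb /= mem_seq1 bv addnC addnA.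
    - by move=> y; rewrite inE bv => /eqP->.
  have [tv|ntv] := boolP (tok v).
    have [g1 g2 g3 g4 g5] := tot1 [:: b] [::] erefl.
    exists (map mkb Kc ++ [:: b]), ([::] ++ map mkb Cc), UU.
    apply: layout_of_blocks => // b'; rewrite inE => /eqP->; rewrite bv; split=> // e.
    by rewrite (perm_mem pb); exact: tokv.
  have [g1 g2 g3 g4 g5] := tot1 [::] [:: b] erefl.
  exists (map mkb Kc ++ [::]), ([:: b] ++ map mkb Cc), UU.
  by apply: layout_of_blocks => // b'; rewrite inE => /eqP->; rewrite bv.
have [okx ok'] : okt x /\ all okt X' by have := okf (fun t => ~~ closed_trail t && (s t.1 != s (trail_end t))); rewrite -/XX EX => /andP[].
have [sx sX'] : s x.1 != s (trail_end x) /\ all (fun t => s t.1 != s (trail_end t)) X' by move: sX; rewrite EX => /andP[].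
have [a1 a2 a3 a4] := @alt_spec true [:: x] ltac:(by rewrite /= okx) ltac:(by rewrite /= sx).
have [b1 b2 b3 b4] := @alt_spec false X' ok' sX'.
have ea : endb true (alt true [:: x]) = false.
  by move: sx; rewrite /=; case Ex: (s x.1); rewrite /= ?lst_rv //; case: (s (trail_end x)).
(* One mixed trail leads from [s] to the other side; the remaining ones follow [WW] and alternate,
   starting there. *)
apply: (nogap (UU ++ alt true [:: x] ++ WW ++ alt false X')).
- by rewrite !all_cat a1 b1 !okf.
- rewrite EX -[x :: X']cat1s !tedges_cat perm_cat2l perm_catCA perm_cat2l.
  by apply: perm_cat.
- rewrite EX -[x :: X']cat1s !fends_cat perm_cat2l perm_catCA perm_cat2l.
  by apply: perm_cat.
- by rewrite !chain_cat cU eU a4 ea cW eW b4.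
Qed.

End Min.

(* The labels alternate from both ends of [1..m] along a chain of trails, so that
   consecutive labels sum to [m.+1] at a vertex outside [s] and to [m] at a vertex of [s]. *)
Lemma bipartite_labeling : (forall u, tok u -> s u && ~~ odd #|[pred w | h u w]|) ->
  exists lab del Lam, bip_labeling h s tok lab del Lam.
Proof.
move=> tokE; have [D decD minD] := min_decomposition tok hU.
have [pre [post [op L]]] := layout_exists decD minD.
by do 3 eexists; apply: (layout_labeling hU tokE L).
Qed.
End Existence.

(** * Levels *)

(** One function levels all components: a root is alone on its level and the level just below is
    empty, so each component is closed off before the next one begins. *)
Record leveling (V : finType) (e : rel V) (lev : V -> nat) (rt : pred V) : Prop := {
  lev_edge : forall u v, e u v -> lev u <= (lev v).+1;
  lev_parent : forall v, ~~ rt v -> exists2 w, e v w & lev v = (lev w).+1;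
  lev_root : forall r v, rt r -> lev v = lev r -> v = r;
  lev_root_nbr : forall r v, rt r -> e r v -> lev v = (lev r).+1;
  lev_root_gap : forall r v, rt r -> (lev v).+1 <> lev r }.

Lemma leveling_exists (V : finType) (e : rel V) :
  symmetric e -> irreflexive e -> exists lev rt, leveling e lev rt.
Proof.
move=> sym irr; have csym := sym_connect_sym sym.
pose walk v n := [exists p : n.-tuple V, path e (root e v) p && (last (root e v) p == v)].
have walkP v n : reflect (exists p, [/\ size p = n, path e (root e v) p & last (root e v) p = v]) (walk v n).
  apply: (iffP existsP) => [[p /andP[pp /eqP lp]]|[p [<- pp lp]]].
    by exists p; rewrite size_tuple.
  by exists (in_tuple p); rewrite /= pp lp eqxx.
have walk_ex v : exists n, walk v n.
  have /connectP[p pp lp] : connect e (root e v) v by rewrite csym connect_root.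
  by exists (size p); apply/walkP; exists p.
pose dist v := ex_minn (walk_ex v).
have dist_min v n : walk v n -> dist v <= n by rewrite /dist; case: ex_minnP => m _; apply.
have dist_walk v : walk v (dist v) by rewrite /dist; case: ex_minnP.
have root_edge u v : e u v -> root e u = root e v.
  by move=> uv; apply/(rootP csym)/connect1.
have dist_edge u v : e u v -> dist v <= (dist u).+1.
  move=> uv; have /walkP[p [sp pp lp]] := dist_walk u; apply: dist_min; apply/walkP.
  exists (rcons p v); rewrite size_rcons sp -(root_edge _ _ uv) rcons_path pp lp uv last_rcons.
  by split.
have dist0 v : dist v = 0 -> root e v = v.
  by move=> d0; have /walkP[p []] := dist_walk v; rewrite d0 => /size0nil->.
have root_dist v : root e v = v -> dist v = 0.
  by move=> rv; apply/eqP; rewrite -leqn0; apply: dist_min; apply/walkP; exists [::].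
have dist_pred v : root e v != v -> exists2 w, e v w & dist v = (dist w).+1.
  move=> rv; have /walkP[p [sp pp lp]] := dist_walk v.
  case: (lastP p) sp pp lp => [sp _ /= lp|q w]; first by rewrite lp eqxx in rv.
  rewrite size_rcons last_rcons rcons_path => sp /andP[pq ew] wv; subst w.
  exists (last (root e v) q); first by rewrite sym.
  have dw : dist (last (root e v) q) <= size q.
    apply: dist_min; apply/walkP; exists q; split=> //; rewrite (root_edge _ _ ew) //.
  by have := dist_edge _ _ ew; lia.
pose M := \max_v dist v; have distM v : dist v <= M by apply: leq_bigmax.
(* Components occupy disjoint ranges of [M.+2] levels; distances use [M.+1] of them, and the spare
   one gives the gap before each root. *)
pose lev v := enum_rank (root e v) * M.+2 + dist v; pose rt := [pred v | root e v == v].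
exists lev, rt; split.
- move=> u v uv; rewrite /lev (root_edge _ _ uv) -addnS leq_add2l.
  by apply: dist_edge; rewrite sym.
- move=> v /dist_pred[w vw dv]; exists w => //.
  by rewrite /lev (root_edge _ _ vw) dv addnS.
- move=> r v /eqP rr; rewrite /lev (root_dist _ rr) addn0 => E.
  have rE : enum_rank (root e v) = enum_rank (root e r) :> nat by have := distM v; nia.
  have dv : dist v = 0 by move: E; rewrite rE; lia.
  by rewrite -rr -(dist0 _ dv); apply/enum_rank_inj/val_inj.
- move=> r v /eqP rr rv; rewrite /lev -(root_edge _ _ rv) (root_dist _ rr).
  have := dist_edge _ _ rv; rewrite (root_dist _ rr).
  case: (posnP (dist v)) => [dv|]; last by lia.
  have vr : v = r by rewrite -rr (root_edge _ _ rv) dist0.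
  by rewrite vr irr in rv.
- move=> r v /eqP rr; rewrite /lev (root_dist _ rr) addn0.
  have := distM v; move: (nat_of_ord _) (nat_of_ord _) (dist v) => a b d dM E.
  by case: (ltngtP a b) => [/leq_mul/(_ (leqnn M.+2))|/leq_mul/(_ (leqnn M.+2))|]; nia.
Qed.

(* [par] is the parent function, [Y] the set of vertices with [d - 1] neighbours one level
   up that are the parent of nobody, and [f w] the token of [w]. *)
Record skeleton (V : finType) (e : rel V) (k : nat) (lev : V -> nat) (rt : pred V)
    (up : rel V) (par : V -> V) (Y : pred V) (f : V -> V) : Prop := {
  sk_up : forall v, ~~ rt v -> up v (par v);
  sk_Yrt : forall w, Y w -> ~~ rt w;
  sk_Ydown : forall w, Y w -> #|[pred u | up u w]| = (2 * k).+1;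
  sk_Yf : forall w, Y w -> up (f w) w;
  sk_Ysg : forall w v, Y w -> ~~ rt v -> par v != w;
  sk_inj : forall w w', Y w -> Y w' -> f w = f w' -> w = w';
  sk_Yup : forall w, Y w -> #|[pred w' | up (f w) w']| = 2 * k + 2;
  sk_count : forall i, (2 * k).+1 * #|[pred w | Y w & lev (f w) == i]| <=
    #|[pred u | (#|[pred w | up u w]| == 2 * k + 2) && (lev u == i)]|;
  sk_nonY : forall w, ~~ rt w -> ~~ Y w -> #|[pred u | up u w]| = (2 * k).+1 ->
    exists2 v, ~~ rt v & par v = w }.

(** [balanced_choice] assigns each vertex of [B] to a farther neighbour, with loads at most two. A
    vertex with a nonempty fiber takes its parent there; so a vertex of [Y] shares its fiber with
    that parent, the load is two, and [f w] lies in [A]. *)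
Lemma skeleton_exists (V : finType) (e : rel V) (k : nat) (lev : V -> nat) (rt : pred V) :
  symmetric e -> (forall u, #|[pred v | e u v]| = 2 * k + 2) -> leveling e lev rt ->
  exists par Y f, skeleton e k lev rt [rel u w | e u w && (lev u == (lev w).+1)] par Y f.
Proof.
move=> sym reg lv; set up := [rel u w | _].
pose B := [pred w | ~~ rt w && (#|[pred u | up u w]| == (2 * k).+1)].
pose A := [pred u | #|[pred w | up u w]| == 2 * k + 2].
have upd u : #|[pred w | up u w]| <= 2 * k + 2.
  by rewrite -(reg u); apply/subset_leq_card/subsetP=> w; rewrite !inE => /andP[].
have up_nrt u w : up u w -> ~~ rt u.
  by case/andP=> uw /eqP lu; apply/negP=> /(lev_root_nbr lv)/(_ uw); lia.
have [f [fB fib2 fibA fibQ]] := @balanced_choice V up A B (2 * k).+1 isT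
  ltac:(by move=> w /andP[_ /eqP <-]; rewrite cardsE)
  ltac:(move=> u; apply: (@leq_trans #|[pred w | up u w]|);
    [by rewrite cardsE; apply/subset_leq_card/subsetP=> w; rewrite !inE => /andP[]
    | by have := upd u; rewrite /A /=; case: eqP => /=; lia]).
have fibP u w : (w \in fiber B f u) = B w && (f w == u) by rewrite inE.
pose par v := odflt (odflt v [pick w | up v w]) [pick w in fiber B f v].
have par_up v : ~~ rt v -> up v (par v).
  move=> nv; rewrite /par; have [w wf|_] /= := pickP [pred w in fiber B f v].
    have /andP[/fB + /eqP E] : B w && (f w == v) by rewrite -fibP.
    by rewrite E.
  case: pickP => [w //|no]; have [w vw lw] := lev_parent lv nv.
  by have := no w; rewrite /up /= vw lw eqxx.
have par_fiber v w : w \in fiber B f v -> par v \in fiber B f v.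
  by move=> wf; rewrite /par; have [//|/(_ w)] := pickP [pred w in fiber B f v]; rewrite /= wf.
pose Y := [pred w | B w && [forall v, ~~ rt v ==> (par v != w)]].
have Yfib w : Y w -> [/\ w \in fiber B f (f w), par (f w) \in fiber B f (f w) & par (f w) != w].
  case/andP=> Bw /forallP/(_ (f w)); rewrite (up_nrt _ _ (fB _ Bw)) /= => ne.
  have wf : w \in fiber B f (f w) by rewrite fibP Bw eqxx.
  by rewrite wf (par_fiber _ _ wf).
have Ycard w : Y w -> #|fiber B f (f w)| = 2.
  case/Yfib=> f1 f2 ne; apply/eqP; rewrite eqn_leq fib2 /=.
  have <- : #|[set par (f w); w]| = 2 by rewrite cards2 ne.
  by apply/subset_leq_card/subsetP=> x; rewrite !inE -!fibP => /orP[]/eqP->.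
have Yinj w w' : Y w -> Y w' -> f w = f w' -> w = w'.
  move=> Yw Yw' E; have [f1 f2 ne] := Yfib _ Yw; have [f3 f4 ne'] := Yfib _ Yw'.
  rewrite -E in f3 f4 ne'; apply/eqP; apply: contraT => ww'.
  have : #|[set par (f w); w; w']| <= #|fiber B f (f w)|.
    by apply/subset_leq_card/subsetP=> x; rewrite !inE -!fibP => /orP[/orP[]|]/eqP->.
  rewrite Ycard // -setUA cardsU1 cards2 ww' !inE (negPf ne) (negPf ne') //.
exists par, Y, f; split=> //.
- by move=> w /andP[/andP[]].
- by move=> w /andP[/andP[_ /eqP]].
- by move=> w /andP[/fB].
- by move=> w v /andP[_ /forallP/(_ v)/implyP].
- by move=> w Yw; apply/eqP; apply: (fibA (f w) (Ycard _ Yw)).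
(* A level is a legitimate [Q]: the farther neighbours of a vertex all lie on one level. *)
- move=> i; have := fibQ [pred u | lev u == i].
  have inv u u' w : up u w -> up u' w -> [pred u | lev u == i] u -> [pred u | lev u == i] u'.
    by rewrite /up /= => /andP[_ /eqP->] /andP[_ /eqP->].
  move=> /(_ inv); rewrite !cardsE => H.
  apply: (@leq_trans _ _ _ (leq_trans _ H)); last first.
    by rewrite eq_leq //; apply: eq_card => u; rewrite !inE andbC.
  rewrite leq_mul2l /=.
  rewrite -(@card_in_imset _ _ f [pred w | Y w & lev (f w) == i]); last first.
    by move=> w w'; rewrite !inE => /andP[Yw _] /andP[Yw' _]; apply: Yinj.
  apply/subset_leq_card/subsetP=> u /imsetP[w]; rewrite inE => /andP[Yw lw] ->.
  by rewrite unfold_in lw Ycard.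
- move=> w nw nY dw; move: nY; rewrite /Y /= nw dw eqxx /= => /forallPn[v].
  by rewrite negb_imply negbK => /andP[nv /eqP]; exists v.
Qed.

(** * Ranks of the parent edges in a level *)

Section Ranks.
Variable V : finType.
Implicit Types (A : pred V) (g : V -> nat).

Lemma range_perm A g a : (forall u, A u -> a <= g u < a + #|A|) ->
  {in A &, injective g} -> perm_eq (map g (enum A)) (iota a #|A|).
Proof.
move=> rg inj; have u1 : uniq (map g (enum A)).
  by rewrite map_inj_in_uniq ?enum_uniq // => u v; rewrite !mem_enum; apply: inj.
have sub : {subset map g (enum A) <= iota a #|A|}.
  by move=> x /mapP[u]; rewrite mem_enum => Au ->; rewrite mem_iota rg.
apply: uniq_perm (iota_uniq _ _) _ => //.
by have [] := uniq_min_size u1 sub; rewrite // size_iota size_map -cardE.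
Qed.

Lemma range_onto A g a x : (forall u, A u -> a <= g u < a + #|A|) ->
  {in A &, injective g} -> a <= x < a + #|A| -> exists2 u, A u & g u = x.
Proof.
move=> rg inj xr; have := perm_mem (range_perm rg inj) x.
by rewrite mem_iota xr => /mapP[u]; rewrite mem_enum => Au ->; exists u.
Qed.

Lemma range_count A g a x : (forall u, A u -> a <= g u < a + #|A|) ->
  {in A &, injective g} -> x <= #|A| -> #|[pred v | A v && (g v < a + x)]| = x.
Proof.
move=> rg inj xA.
transitivity (count (fun y => y < a + x) (map g (enum A))).
  by rewrite count_map -sum1_count big_enum_cond sum1_card /=; apply: eq_card => v; rewrite !inE.
rewrite (permP (range_perm rg inj)) -(subnKC xA) iotaD count_cat.
have -> : count (fun y => y < a + x) (iota a x) = x.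
  rewrite -[RHS](size_iota a); apply/eqP; rewrite -all_count; apply/allP=> y.
  by rewrite mem_iota => /andP[].
rewrite (_ : count _ _ = 0) ?addn0 //; apply/eqP; rewrite -leqn0 leqNgt -has_count.
by apply/hasPn=> y; rewrite mem_iota -leqNgt => /andP[].
Qed.

Definition rk A (key : V -> nat) u := #|[pred v | A v && (key v < key u)]|.

Section Rk.
Variables (A : pred V) (key : V -> nat).
Hypothesis key_inj : injective key.

Lemma rk_lt u v : A u -> key u < key v -> rk A key u < rk A key v.
Proof.
move=> Au uv; apply/proper_card/properP; split.
  by apply/subsetP=> x; rewrite !inE => /andP[-> /ltn_trans->].
by exists u; rewrite !inE Au ?uv // ltnn.
Qed.

Lemma rk_max u : A u -> rk A key u < #|A|.
Proof.
move=> Au; apply/proper_card/properP; split.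
  by apply/subsetP=> x; rewrite !inE => /andP[].
by exists u => //; rewrite !inE ltnn andbF.
Qed.

Lemma rk_inj u v : A u -> A v -> rk A key u = rk A key v -> u = v.
Proof.
move=> Au Av E; apply: key_inj; case: (ltngtP (key u) (key v)) => //.
  by move/(rk_lt Au); rewrite E ltnn.
by move/(rk_lt Av); rewrite E ltnn.
Qed.

Lemma rk_onto j : j < #|A| -> exists2 u, A u & rk A key u = j.
Proof.
move=> jA; apply: (range_onto (a := 0)) => //; first by move=> u; exact: rk_max.
by move=> u v; exact: rk_inj.
Qed.
End Rk.

Definition tkey (g : V -> nat) u := g u * #|V| + enum_rank u.

Lemma tkey_lt g u v : g u < g v -> tkey g u < tkey g v.
Proof.
move=> uv; rewrite /tkey; apply: (@leq_trans ((g u).+1 * #|V|)).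
  by rewrite mulSn addnC ltn_add2r.
by rewrite (leq_trans (leq_mul uv (leqnn _))) // leq_addr.
Qed.

Lemma tkey_le g u v : tkey g u < tkey g v -> g u <= g v.
Proof. by move=> uv; rewrite leqNgt; apply: contraL uv => /tkey_lt vu; rewrite -leqNgt ltnW. Qed.

Lemma tkey_inj g : injective (tkey g).
Proof.
move=> u v E; have gE : g u = g v.
  case: (ltngtP (g u) (g v)) => // /tkey_lt; rewrite E ltnn //.
by move: E; rewrite /tkey gE => /addnI/val_inj/enum_rank_inj.
Qed.

(* [t0] is the number of tokens that take the top ranks; the sum of such a token has the
   parity opposite to [#|A| + beta]. *)
Record ranking (A U tok : pred V) (del p : V -> nat) (Lam beta : nat)
    (rho idx : V -> nat) (t0 : nat) : Prop := {
  rho_range : forall u, A u -> 1 <= rho u <= #|A|;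
  rho_inj : forall u v, A u -> A v -> rho u = rho v -> u = v;
  idx_range : forall u, tok u -> 1 <= idx u <= #|tok|;
  idx_inj : forall u v, tok u -> tok v -> idx u = idx v -> u = v;
  rho_ord : forall u, A u -> ~~ tok u -> rho u + t0 <= #|A|;
  rho_mono : forall u v, A u -> ~~ tok u -> A v -> ~~ tok v -> u != v ->
    (p u <= p v) && (rho u < rho v) || (p v <= p u) && (rho v < rho u);
  rho_gt : forall u, A u -> ~~ tok u ->
    #|[pred v | [&& A v, ~~ tok v & p v < p u]]| < rho u;
  rho_first : forall u, A u -> ~~ tok u ->
    #|[pred v | [&& A v, ~~ tok v & p v < p u]]| + #|U| < #|A| ->
    (forall v, A v -> ~~ tok v -> p v = p u -> v = u) ->
    rho u = #|[pred v | [&& A v, ~~ tok v & p v < p u]]|.+1;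
  rho_tok : forall u, tok u -> #|A| < rho u + #|U|;
  t0_le : t0 <= #|tok|;
  tok_sum_inj : forall u v, tok u -> tok v ->
    del u + idx u + rho u = del v + idx v + rho v -> u = v;
  tok_sum_gt : forall u, tok u -> #|A| < del u + idx u + rho u + t0 + Lam;
  tok_sum_le : forall u, tok u -> del u + idx u + rho u <= #|A| + t0 + 1;
  tok_sum_ne : forall u x, tok u -> 0 < x ->
    del u + idx u + rho u != #|A| + beta + 2 * x }.

Section TokenRanks.
Variables (A U tok : pred V) (del p : V -> nat) (k Lam beta : nat).
Hypothesis k1 : 0 < k.
Hypothesis tokU : forall u, tok u -> U u.
Hypothesis UA : forall u, U u -> A u.
Hypothesis cardU : (2 * k).+1 * #|tok| <= #|U|.
Hypothesis sum_del : \sum_(u | tok u) del u <= Lam.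
Hypothesis LamE : Lam <= k * #|tok|.

Let n := #|A|.
Let t := #|tok|.
Let r u := rk tok (tkey del) u.
Let z := #|[pred u | tok u && (del u == 0)]|.
(** If [z] has the wrong parity, one token without excess is left out, so that [t0 + beta] is odd
    whenever [t0] is positive. *)
Let t0 := if z == 0 then 0 else if odd (z + beta) then z else z.-1.
(** With [idx u = (r u).+1], the total [del u + idx u + rho u] is [n - t0 + 2 * idx u] for the first
    [t0] tokens and [n - r u + 1] for the others: the former rise in steps of two from [n - t0 + 2],
    the latter fall one by one from [n - t0 + 1]. *)
Let trho u := if r u < t0 then (n - t0 + r u).+1 else n - (2 * r u + del u).
Let ord := [pred u | A u && ~~ tok u].
Let j u := rk ord (tkey p) u.
Let cp := [seq x <- iota 1 n | x \notin map trho (enum tok)].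
Let rho u := if tok u then trho u else nth 0 cp (j u).
Let idx u := (r u).+1.

Let tokA u : tok u -> A u. Proof. by move/tokU/UA. Qed.

Let t0z : t0 <= z. Proof. by rewrite /t0; case: eqP => // _; case: ifP => // _; exact: leq_pred. Qed.
Let t0z1 : z <= t0.+1. Proof. by rewrite /t0; case: eqP => [->|] // _; case: ifP => // _; lia. Qed.

Let t0odd : 0 < t0 -> odd (t0 + beta).
Proof. by rewrite /t0; case: eqP => // _; case: ifP => // o1 o2; lia. Qed.

Let zt : z <= t.
Proof. by apply/subset_leq_card/subsetP=> u; rewrite !inE => /andP[]. Qed.

Let Un : #|U| <= n.
Proof. by apply/subset_leq_card/subsetP=> u; apply: UA. Qed.

Let del_le u : tok u -> del u <= Lam.
Proof. by move=> tu; apply: leq_trans sum_del; rewrite (bigD1 u) //= leq_addr. Qed.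

Let tz : t <= z + Lam.
Proof.
rewrite /t /z -(cardID [pred u | del u == 0] tok); apply: leq_add.
  by rewrite eq_leq //; apply: eq_card => u; rewrite !inE andbC.
rewrite -sum1_card; apply: leq_trans sum_del; rewrite big_mkcond [X in _ <= X]big_mkcond /=.
apply: leq_sum => u _; rewrite !inE -[u \in tok]/(tok u).
by case: (tok u); rewrite ?andbF // andbT; case: (del u).
Qed.

Let r_lt u : tok u -> r u < t. Proof. exact: rk_max. Qed.

Let r_z u : tok u -> (r u < z) = (del u == 0).
Proof.
move=> tu; apply/idP/idP.
  move=> rz; apply: contraLR rz => d0; rewrite -leqNgt.
  apply/subset_leq_card/subsetP=> v; rewrite !inE => /andP[-> /eqP dv] /=.
  by apply: tkey_lt; rewrite dv lt0n.
move=> /eqP d0; apply/proper_card/properP; split.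
  by apply/subsetP=> v; rewrite !inE => /andP[-> /tkey_le]; rewrite d0 leqn0.
by exists u; rewrite !inE tu ?d0 // ltnn.
Qed.

Let r_del u v : tok u -> tok v -> r u < r v -> del u <= del v.
Proof.
move=> tu tv; rewrite ltnNge => uv; apply: (@tkey_le del); rewrite ltnNge.
apply: contra uv; rewrite leq_eqVlt => /orP[/eqP/tkey_inj->//|]; move/(rk_lt tv).
exact: ltnW.
Qed.

Let r_inj u v : tok u -> tok v -> r u = r v -> u = v.
Proof. by apply: rk_inj; apply: tkey_inj. Qed.

(* [2 (t - 1) + k t + 1 <= (2 k + 1) t] because [k >= 1]. *)
Let trho_big u : tok u -> n < trho u + #|U|.
Proof.
move=> tu; have := r_lt tu; have := del_le tu; have := cardU; have := LamE; have := Un.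
have := zt; have := t0z; have := k1; rewrite /trho -/t.
move: (r u) (del u) #|U| n => x y u' n'; clear.
by case: ifP => _; nia.
Qed.

Let trho_range u : tok u -> 1 <= trho u <= n.
Proof.
move=> tu; have := trho_big tu; have := Un; have := r_lt tu; have := zt; have := t0z.
rewrite /trho; case: ifP => rt0.
  have := cardU; rewrite -/t; nia.
by lia.
Qed.

Let trho_inj u v : tok u -> tok v -> trho u = trho v -> u = v.
Proof.
move=> tu tv E; apply: r_inj => //.
have h1 := @r_del _ _ tu tv; have h2 := @r_del _ _ tv tu.
have := trho_big tu; have := trho_big tv; have := Un; have := cardU; have := r_lt tu; have := r_lt tv.
have := t0z; have := zt; have := k1; move: E h1 h2; rewrite /trho -/t.
move: (r u) (r v) (del u) (del v) #|U| n => x y a b u' n'; clear.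
case: ifP => xt; case: ifP => yt E h1 h2 *; case: (ltngtP x y) h1 h2 => // xy h1 h2;
  try have := h1 isT; try have := h2 isT; nia.
Qed.

Let T u := del u + idx u + rho u.

Let T1 u : tok u -> r u < t0 -> T u = n - t0 + 2 * idx u.
Proof.
move=> tu rt; have : del u == 0 by rewrite -r_z // (leq_trans rt t0z).
by move=> /eqP d0; rewrite /T d0 /rho tu /trho rt /idx; lia.
Qed.

Let T2 u : tok u -> t0 <= r u -> T u = (n - r u).+1.
Proof.
move=> tu rt; have := trho_range tu; have := trho_big tu; have := Un; rewrite /T /rho tu /trho (ltnNge (r u) t0) rt /= /idx; lia.
Qed.

Let utrho : uniq (map trho (enum tok)).
Proof. by rewrite map_inj_in_uniq ?enum_uniq // => u v; rewrite !mem_enum; apply: trho_inj. Qed.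

Let cp_sorted : sorted ltn cp.
Proof. by apply: sorted_filter (iota_ltn_sorted _ _); exact: ltn_trans. Qed.

Let card_ord : #|ord| + t = n.
Proof.
rewrite /n -(cardID tok A) addnC; congr (_ + _); apply: eq_card => u; rewrite !inE //=.
  by rewrite -[u \in tok]/(tok u) -[u \in A]/(A u); case tu: (tok u); rewrite ?andbF ?andbT ?(tokA tu).
by rewrite andbC.
Qed.

Let size_cp : size cp = #|ord|.
Proof.
have ct : count (fun x => x \in map trho (enum tok)) (iota 1 n) = t.
  transitivity (size (map trho (enum tok))); last by rewrite size_map -cardE.
  rewrite -size_filter; apply: perm_size; apply: uniq_perm => //; first by rewrite filter_uniq ?iota_uniq.
  move=> x; rewrite mem_filter; case: mapP => //= -[u]; rewrite mem_enum => tu ->.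
  by rewrite mem_iota; have := trho_range tu; lia.
have := count_predC (fun x => x \in map trho (enum tok)) (iota 1 n).
by rewrite ct size_iota => E; apply: (@addnI t); rewrite [RHS]addnC card_ord -E size_filter.
Qed.

Let cp_ge i : i < size cp -> i < nth 0 cp i.
Proof.
elim: i => [|i IH] ic.
  by have := mem_nth 0 ic; rewrite mem_filter mem_iota => /and3P[].
apply: leq_ltn_trans (IH (ltnW ic)) _.
by apply: (sorted_ltn_nth ltn_trans) => //; rewrite inE // ltnW.
Qed.

Let cp_mem i : i < size cp -> [/\ nth 0 cp i <= n - t0, 0 < nth 0 cp i &
  nth 0 cp i \notin map trho (enum tok)].
Proof.
move=> ic; have := mem_nth 0 ic; set x := nth 0 cp i.
rewrite mem_filter mem_iota => /andP[xn /andP[x0 x1]]; split=> //.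
rewrite leqNgt; apply: contra xn => xt; apply/mapP.
have xr : x.-1 - (n - t0) < t by have := t0z; have := zt; lia.
have [u tu ru] := rk_onto (@tkey_inj del) xr.
exists u; first by rewrite mem_enum.
by rewrite /trho /r ru; case: ifP; have := t0z; have := zt; lia.
Qed.

(** Token ranks all exceed [n - #|U|], so no rank up to there is missing from [cp]: the smallest
    sums get their position as rank. *)
Let cp_prefix i : i + #|U| < n -> nth 0 cp i = i.+1.
Proof.
move=> iU; have -> : cp = iota 1 (n - #|U|) ++
    [seq x <- iota (1 + (n - #|U|)) #|U| | x \notin map trho (enum tok)].
  rewrite /cp -{1}(subnK Un) iotaD filter_cat; congr (_ ++ _).
  apply/all_filterP/allP=> x; rewrite mem_iota => xr; apply/mapP=> -[u]; rewrite mem_enum => tu xE.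
  by have := trho_big tu; lia.
by rewrite nth_cat size_iota ltn_subRL addnC iU nth_iota ?add1n // ltn_subRL addnC.
Qed.

Let j_lt u : ord u -> j u < size cp.
Proof. by move=> ou; rewrite size_cp; apply: rk_max. Qed.

Lemma token_ranks : exists rho idx t0, ranking A U tok del p Lam beta rho idx t0.
Proof.
have ordP u : A u -> ~~ tok u -> ord u by move=> Au tu; rewrite /ord /= Au tu.
have jle u : #|[pred v | [&& A v, ~~ tok v & p v < p u]]| <= j u.
  by apply/subset_leq_card/subsetP=> v; rewrite !inE => /and3P[-> -> /tkey_lt].
exists rho, idx, t0; split=> //.
- move=> u Au; rewrite /rho; case: ifPn => tu; first exact: trho_range.
  by have [h1 h2 _] := cp_mem (j_lt (ordP _ Au tu)); rewrite h2 (leq_trans h1) // leq_subr.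
- move=> u v Au Av; rewrite /rho; case: ifPn => tu; case: ifPn => tv.
  + exact: trho_inj.
  + move=> E; have [_ _] := cp_mem (j_lt (ordP _ Av tv)).
    by rewrite -E map_f ?mem_enum.
  + move=> E; have [_ _] := cp_mem (j_lt (ordP _ Au tu)).
    by rewrite E map_f ?mem_enum.
  + move=> /eqP; rewrite nth_uniq ?j_lt ?ordP //; last by rewrite filter_uniq ?iota_uniq.
    by move=> /eqP; apply: rk_inj; rewrite ?ordP //; exact: tkey_inj.
- by move=> u v tu tv [] /r_inj; apply.
- move=> u Au tu; rewrite /rho (negPf tu).
  have [h1 _ _] := cp_mem (j_lt (ordP _ Au tu)); have := t0z; have := zt; have := card_ord; lia.
- move=> u v Au tu Av tv uv; rewrite /rho (negPf tu) (negPf tv).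
  have mono a b : ord a -> ord b -> tkey p a < tkey p b -> (p a <= p b) && (nth 0 cp (j a) < nth 0 cp (j b)).
    move=> oa ob ab; rewrite (tkey_le ab); apply: (sorted_ltn_nth ltn_trans) => //; rewrite ?inE ?j_lt //.
    exact: rk_lt.
  case: (ltngtP (tkey p u) (tkey p v)) => [/mono->|/mono->|/tkey_inj E]; rewrite ?orbT ?ordP //.
  by rewrite E eqxx in uv.
- by move=> u Au tu; rewrite /rho (negPf tu) (leq_ltn_trans (jle u)) // cp_ge // j_lt // ordP.
- move=> u Au tu ju uni; have jE : #|[pred v | [&& A v, ~~ tok v & p v < p u]]| = j u.
    apply: eq_card => v; rewrite !inE -andbA; case Av: (A v) => //=; case tv: (tok v) => //=.
    apply/idP/idP => [/tkey_lt//|uv]; have := tkey_le uv; rewrite leq_eqVlt => /orP[/eqP E|//].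
    by move: uv; rewrite (uni v) ?tv ?Av ?ltnn.
  by rewrite jE in ju *; rewrite /rho (negPf tu) cp_prefix.
- by move=> u tu; rewrite /rho tu; exact: trho_big.
- exact: leq_trans t0z zt.
- move=> u v tu tv; rewrite -/(T u) -/(T v) => E; apply: r_inj => //.
  have := t0z; have := zt; have := r_lt tu; have := r_lt tv; have := card_ord.
  case: (ltnP (r u) t0) => ru; case: (ltnP (r v) t0) => rv; move: E;
    rewrite ?(T1 tu ru) ?(T2 tu ru) ?(T1 tv rv) ?(T2 tv rv) /idx; lia.
- move=> u tu; rewrite -/(T u); have := t0z; have := zt; have := r_lt tu; have := card_ord.
  have := tz; have := t0z1.
  case: (ltnP (r u) t0) => ru; rewrite ?(T1 tu ru) ?(T2 tu ru) -?/n -?/t /idx; lia.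
- move=> u tu; rewrite -/(T u); have := t0z; have := zt; have := r_lt tu; have := card_ord.
  case: (ltnP (r u) t0) => ru; rewrite ?(T1 tu ru) ?(T2 tu ru) -?/n -?/t /idx; lia.
- move=> u x tu x0; rewrite -/(T u); apply/eqP.
  have := t0z; have := zt; have := r_lt tu; have := card_ord; have := t0odd.
  case: (ltnP (r u) t0) => ru; rewrite ?(T1 tu ru) ?(T2 tu ru) /idx; lia.
Qed.
End TokenRanks.
End Ranks.

(** * Labelling level by level *)

Lemma sum_lt (I J : finType) (A : pred I) (B : pred J) (F : I -> nat) (G : J -> nat) :
  #|A| = #|B| -> 0 < #|A| -> (forall a b, A a -> B b -> F a < G b) ->
  \sum_(a | A a) F a < \sum_(b | B b) G b.
Proof.
move=> AB A0 FG; pose M := \max_(a | A a) F a.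
have le1 : \sum_(a | A a) F a <= #|A| * M.
  by rewrite -sum_nat_const; apply: leq_sum => a Aa; apply: leq_bigmax_cond.
have le2 : #|B| * M.+1 <= \sum_(b | B b) G b.
  rewrite -sum_nat_const; apply: leq_sum => b Bb.
  have [a Aa Ma] := eq_bigmax_cond F A0; rewrite (_ : M = F a) //; exact: FG.
by apply: leq_trans le2; apply: leq_ltn_trans le1 _; rewrite -AB ltn_pmul2l.
Qed.

Section Levels.
Variables (V : finType) (e : rel V) (k : nat) (lev : V -> nat) (rt : pred V).
Variables (par : V -> V) (Y : pred V) (f : V -> V).
Local Notation up := [rel u w | e u w && (lev u == (lev w).+1)].
Hypothesis sym : symmetric e.
Hypothesis irr : irreflexive e.
Hypothesis k1 : 0 < k.
Hypothesis reg : forall u, #|[pred v | e u v]| = 2 * k + 2.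
Hypothesis lv : leveling e lev rt.
Hypothesis sk : skeleton e k lev rt up par Y f.

(* The edges labelled once levels [>= i] are processed. *)
Definition late i u v := e u v && (i <= maxn (lev u) (lev v)).
(* Edges towards the root that are neither parent edges nor token edges. *)
Definition free_rel i u w := [&& e u w, lev u == (lev w).+1, lev u == i, par u != w & ~~ (Y w && (f w == u))].
Definition flat_edges i := enum [pred p : V * V | [&& e p.1 p.2, lev p.1 == i, lev p.2 == i & enum_rank p.1 < enum_rank p.2]].
Definition nb_flat i := size (flat_edges i).
Definition nb_free i := #|[pred p : V * V | free_rel i p.1 p.2]|.
Definition nb_tok i := #|[pred w | Y w & lev (f w) == i]|.
Definition nb_nonparent i := nb_flat i + nb_free i + nb_tok i.
Definition phi (lab : V -> V -> nat) u := \sum_(w | e u w) lab u w.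
Definition upper_sum (lab : V -> V -> nat) i w := \sum_(u | e w u && (lev u == i)) lab w u.
Definition down_deg w := #|[pred u | up u w]|.

(* The last five fields control the level [i.-1] still to come: the sums at its vertices
   of [Y] are known up to their parent edge, the others are larger, and the final sums at
   level [i] miss the values that [Y] will take, [P] being the number of labels used. *)
Record partial_labeling (i : nat) (lab : V -> V -> nat) (P c0 : nat) (idx : V -> nat) : Prop := {
  I_sym : forall u v, lab u v = lab v u;
  I_range : forall u v, late i u v -> 0 < lab u v <= P;
  I_onto : forall l, 0 < l <= P -> exists u v, late i u v /\ lab u v = l;
  I_inj : forall u v u' v', late i u v -> late i u' v' -> lab u v = lab u' v' ->
    (u = u' /\ v = v') \/ (u = v' /\ v = u');
  I_ord : forall u v u' v', late i u v -> late i u' v' ->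
    maxn (lev u) (lev v) < maxn (lev u') (lev v') -> lab u' v' < lab u v;
  I_phi : forall u v, i <= lev u -> i <= lev v -> phi lab u = phi lab v -> u = v;
  I_sg : forall u v w, ~~ rt u -> ~~ rt v -> lev u = i -> lev v = i ->
    e u w -> w != par u -> lab u w < lab v (par v);
  I_Y : forall w, Y w -> (lev w).+1 = i -> upper_sum lab i w = c0 + idx w /\ 0 < idx w <= nb_tok i;
  I_Yinj : forall w w', Y w -> Y w' -> (lev w).+1 = i -> (lev w').+1 = i ->
    idx w = idx w' -> w = w';
  I_nonY : forall w, ~~ rt w -> ~~ Y w -> (lev w).+1 = i ->
    c0 + nb_tok i < upper_sum lab i w + ((2 * k).+1 - down_deg w) * P.+1;
  I_phi_lt : forall u, ~~ rt u -> lev u = i ->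
    phi lab u < c0 + P + nb_nonparent i.-1 + 2 * nb_tok i + 2;
  I_phi_ne : forall u x, ~~ rt u -> lev u = i -> 0 < x <= nb_tok i ->
    phi lab u != c0 + P + nb_nonparent i.-1 + 2 * x }.

Lemma lev_edge2 u v : e u v -> lev u <= (lev v).+1 /\ lev v <= (lev u).+1.
Proof. by move=> uv; split; apply: (lev_edge lv) => //; rewrite sym. Qed.

Lemma par_up v : ~~ rt v -> e v (par v) /\ lev v = (lev (par v)).+1.
Proof. by move/(sk_up sk)/andP=> [? /eqP]. Qed.

Lemma Y_up w : Y w -> e (f w) w /\ lev (f w) = (lev w).+1.
Proof. by move/(sk_Yf sk)/andP=> [? /eqP]. Qed.

Lemma phi_far i lab u v :
  (forall u v u' v', late i u v -> late i u' v' ->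
    maxn (lev u) (lev v) < maxn (lev u') (lev v') -> lab u' v' < lab u v) ->
  i <= lev u -> (lev u).+1 < lev v -> phi lab v < phi lab u.
Proof.
move=> ord iu uv; apply: sum_lt; rewrite ?reg ?addn2 //.
move=> a b va ub; have [h1 h2] := lev_edge2 va; have [h3 h4] := lev_edge2 ub.
by apply: ord; rewrite /late ?va ?ub /=; lia.
Qed.

Lemma partial_labeling_start : exists i lab P c0 idx, partial_labeling i lab P c0 idx.
Proof.
pose M := \max_v lev v; have levM v : lev v < M.+1 by rewrite ltnS leq_bigmax.
have nolate u v : late M.+1 u v = false.
  by apply/negP=> /andP[_]; have := levM u; have := levM v; lia.
exists M.+1, (fun _ _ => 0), 0, 0, (fun=> 0).
have dd0 w : (lev w).+1 = M.+1 -> down_deg w = 0.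
  move=> lw; apply: eq_card0 => u; rewrite !inE; apply/negP=> /andP[_ /eqP lu].
  by have := levM u; lia.
split=> //; try by (move=> u v *; have := levM u; have := levM v; lia).
- by move=> u v; rewrite nolate.
- by move=> l; lia.
- by move=> u v u' v'; rewrite nolate.
- by move=> u v u' v'; rewrite nolate.
- by move=> w Yw /dd0; rewrite /down_deg (sk_Ydown sk Yw).
- by move=> w w' Yw _ /dd0; rewrite /down_deg (sk_Ydown sk Yw).
- move=> w nw nY lw; rewrite dd0 // /nb_tok eq_card0; first by lia.
  move=> y; rewrite !inE; apply/negP=> /andP[_ /eqP]; have := levM (f y); lia.
- by move=> u _ lu; have := levM u; rewrite lu ltnn.
- by move=> u x _ lu; have := levM u; rewrite lu ltnn.
Qed.

(** The edges at a root are parent edges of the next level and already labelled. No vertex [w] has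
    [(lev w).+1 = i], so [c0] and [idx] are dummies. *)
Lemma partial_labeling_root i lab P c0 idx r : rt r -> lev r = i -> partial_labeling i.+1 lab P c0 idx ->
  partial_labeling i lab P 0 (fun=> 0).
Proof.
move=> rr lr I.
have lr_only v : lev v = i -> v = r by move=> li; apply: (lev_root lv rr); rewrite li.
have lateE u v : late i u v = late i.+1 u v.
  rewrite /late; case uv: (e u v) => //=; apply/idP/idP; last by lia.
  have vu : e v u by rewrite sym.
  case: (ltngtP i (maxn (lev u) (lev v))) => // im _.
  case: (leqP (lev v) (lev u)) => uvl.
    have ur : u = r by apply: lr_only; lia.
    by have := lev_root_nbr lv rr (v := v); rewrite -{1}ur => /(_ uv); lia.
  have ur : v = r by apply: lr_only; lia.
  by have := lev_root_nbr lv rr (v := u); rewrite -{1}ur => /(_ vu); lia.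
have ord u v u' v' : late i u v -> late i u' v' ->
    maxn (lev u) (lev v) < maxn (lev u') (lev v') -> lab u' v' < lab u v.
  by rewrite !lateE; apply: (I_ord I).
have nrt1 v : lev v = i.+1 -> ~~ rt v.
  by move=> lv1; apply/negP=> rv; apply: (lev_root_gap lv rv (v := r)); rewrite lr.
(* For [v] adjacent to the root, the common edge cancels; by [I_sg] every other edge at [v] has a
   smaller label than any edge at [r], and there are [(2 * k).+1] on each side. *)
have root_lt v : i < lev v -> phi lab v < phi lab r.
  move=> iv; case: (ltnP i.+1 (lev v)) => iv1.
    by apply: (phi_far ord); rewrite lr.
  have lv1 : lev v = i.+1 by lia.
  have nv := nrt1 _ lv1; have [vs ls] := par_up nv.
  have sr u : lev u = i.+1 -> par u = r.
    by move=> lu; apply: lr_only; have [_] := par_up (nrt1 _ lu); lia.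
  have rv : e r v by rewrite sym -(sr _ lv1).
  have vr : e v r by rewrite sym.
  rewrite /phi (bigD1 r) //= [X in _ < X](bigD1 v) //= (I_sym I) ltn_add2l.
  have c1 : #|[pred w | e v w & w != r]| = (2 * k).+1.
    have := reg v; rewrite (cardD1 r) inE vr => E; apply/eqP; rewrite -(eqn_add2l 1) -[1 + (2*k).+1]addnC addn1 -addn2 -E.
    by apply/eqP; congr (1 + _); apply: eq_card => w; rewrite !inE andbC.
  have c2 : #|[pred w | e r w & w != v]| = (2 * k).+1.
    have := reg r; rewrite (cardD1 v) inE rv => E; apply/eqP; rewrite -(eqn_add2l 1) -[1 + (2*k).+1]addnC addn1 -addn2 -E.
    by apply/eqP; congr (1 + _); apply: eq_card => w; rewrite !inE andbC.
  apply: (@sum_lt _ _ [pred w | e v w & w != r] [pred w | e r w & w != v]); rewrite ?c1 ?c2 //.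
  move=> w w' /andP[vw wr] /andP[rw' w'v].
  have lw' : lev w' = i.+1 by rewrite (lev_root_nbr lv rr rw') lr.
  rewrite (I_sym I r) -(sr _ lw'); apply: (I_sg I) => //; first exact: nrt1.
  by rewrite sr.
split.
- exact: I_sym I.
- by move=> u v; rewrite lateE; apply: I_range I _ _.
- by move=> l /(I_onto I)[u [v [uv <-]]]; exists u, v; rewrite lateE.
- by move=> u v u' v'; rewrite !lateE; apply: I_inj I _ _ _ _.
- exact: ord.
- move=> u v iu iv E; case: (ltngtP i (lev u)) iu => // iu _; case: (ltngtP i (lev v)) iv => // iv _.
  + exact: I_phi I _ _ iu iv E.
  + by have := root_lt _ iu; rewrite E (lr_only v) // ltnn.
  + by have := root_lt _ iv; rewrite -E (lr_only u) // ltnn.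
  + by rewrite (lr_only u) // (lr_only v).
- by move=> u v w nu _ /lr_only ur; rewrite ur rr in nu.
- by move=> w _ lw; case: (lev_root_gap lv rr (v := w)); rewrite lr.
- by move=> w w' _ _ lw; case: (lev_root_gap lv rr (v := w)); rewrite lr.
- by move=> w _ _ lw; case: (lev_root_gap lv rr (v := w)); rewrite lr.
- by move=> u nu /lr_only ur; rewrite ur rr in nu.
- by move=> u x nu /lr_only ur; rewrite ur rr in nu.
Qed.

(** * Adding the labels of a level without root *)

Section Step.
Variable i : nat.
Hypothesis nroot : forall v, lev v = i -> ~~ rt v.

Definition token u := (lev u == i) && [exists w, Y w && (f w == u)].

Lemma sum_down_nbr u (F : V -> nat) : lev u = i ->
  \sum_(w | up u w) F w =
    \sum_(w | free_rel i u w) F w + F (par u) + \sum_(w | Y w && (f w == u)) F w.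
Proof.
move=> lu; have [us ls] := par_up (nroot lu).
rewrite (bigD1 (par u)) /=; last by rewrite us ls eqxx.
rewrite addnAC [RHS]addnC; congr (_ + _).
rewrite (bigID (fun w => Y w && (f w == u))) /= addnC; congr (_ + _).
  by apply: eq_bigl => w; rewrite /free_rel lu eqxx /= [par u == w]eq_sym -!andbA.
apply: eq_bigl => w; apply/idP/idP => [/andP[]//|/andP[Yw /eqP fw]].
have [ew lw] := Y_up Yw; rewrite Yw fw eqxx -fw ew lw eqxx /= andbT fw eq_sym.
exact: (sk_Ysg sk Yw (nroot lu)).
Qed.

Lemma sum_nbr u (F : V -> nat) : lev u = i ->
  \sum_(w | e u w) F w = \sum_(w | e u w && (i < lev w)) F w +
    \sum_(w | e u w && (lev w == i)) F w + \sum_(w | up u w) F w.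
Proof.
move=> lu; rewrite (bigID (fun w => i < lev w)) /= -addnA; congr (_ + _).
rewrite (bigID (fun w => lev w == i)) /=; congr (_ + _); apply: eq_bigl => w.
  by case: (e u w) => //=; case: (ltngtP i (lev w)); lia.
rewrite lu; case uw: (e u w) => //=; have [h1 h2] := lev_edge2 uw.
by case: (ltngtP i (lev w)) => //=; lia.
Qed.

Lemma sum_up_nbr w (F : V -> nat) : (lev w).+1 = i ->
  \sum_(u | e w u && (lev u == i)) F u = \sum_(u | free_rel i u w) F u +
    \sum_(u | [&& e w u, lev u == i & par u == w]) F u + (if Y w then F (f w) else 0).
Proof.
move=> lw; rewrite (bigID (fun u => par u == w)) /= [RHS]addnAC [RHS]addnC.
congr (_ + _); first by apply: eq_bigl => u; rewrite -andbA.
rewrite (bigID (fun u => Y w && (f w == u))) /= addnC; congr (_ + _).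
  apply: eq_bigl => u; rewrite /free_rel lw -!andbA (sym u w).
  by case: (e w u); case: (lev u == i).
case Yw: (Y w) => /=; last by rewrite big_pred0 // => u; rewrite !andbF.
have [ew lf] := Y_up Yw; apply: big_pred1 => u; apply/idP/idP.
  by case/andP=> _; rewrite eq_sym.
move/eqP=> ->; rewrite sym ew lf lw !eqxx /= andbT.
by apply: (sk_Ysg sk Yw); apply: nroot; rewrite lf.
Qed.

Lemma tok_sum u : token u -> exists y, [/\ Y y, f y = u &
  forall F : V -> nat, \sum_(w | Y w && (f w == u)) F w = F y].
Proof.
case/andP=> _ /existsP[y /andP[Yy /eqP fy]]; exists y; split=> // F; apply: big_pred1 => w.
apply/idP/idP => [/andP[Yw /eqP fw]|/eqP->]; last by rewrite Yy fy /=.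
by apply/eqP/(sk_inj sk) => //; rewrite fw.
Qed.

Lemma nontok_sum u (F : V -> nat) : lev u = i -> ~~ token u -> \sum_(w | Y w && (f w == u)) F w = 0.
Proof.
move=> lu nt; apply: big_pred0 => w; apply: contraNF nt => Yf; rewrite /token /= lu eqxx.
by apply/existsP; exists w.
Qed.

Lemma tok_sum1 u : lev u = i -> \sum_(w | Y w && (f w == u)) 1 = token u.
Proof.
by move=> lu; case tu: (token u); [have [y [_ _ ->]] := tok_sum tu | rewrite nontok_sum ?tu].
Qed.

Let ud u := #|[pred w | up u w]|.
Let hd u := #|[pred w | free_rel i u w]|.

Lemma udE u : lev u = i -> ud u = hd u + 1 + token u.
Proof. by move=> lu; rewrite /ud /hd -!sum1_card sum_down_nbr // tok_sum1. Qed.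

Let du u := #|[pred w | e u w && (i < lev w)]|.
Let su u := #|[pred w | e u w && (lev w == i)]|.

Lemma degE u : lev u = i -> du u + su u + ud u = 2 * k + 2.
Proof. by move=> lu; rewrite -(reg u) /ud /su /du -!sum1_card sum_nbr. Qed.

Lemma ddE u : lev u = i -> down_deg u = du u.
Proof.
move=> lu; apply: eq_card => w; rewrite !inE lu (sym w u); case uw: (e u w) => //=.
by have [h1 h2] := lev_edge2 uw; apply/idP/idP; lia.
Qed.

Lemma tok_ud u : token u -> ud u = 2 * k + 2.
Proof. by move=> tu; have [y [Yy <- _]] := tok_sum tu; exact: (sk_Yup sk Yy). Qed.

Lemma tok_lev u : token u -> lev u = i.
Proof. by case/andP=> /eqP. Qed.

Lemma tok_hd u : token u -> hd u = 2 * k.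
Proof. by move=> tu; have := udE (tok_lev tu); rewrite tok_ud // tu; lia. Qed.

Lemma card_tok : #|token| = nb_tok i.
Proof.
rewrite /nb_tok -(@card_in_imset _ _ f [pred w | Y w & lev (f w) == i]); last first.
  by move=> w w'; rewrite !inE => /andP[Yw _] /andP[Yw' _]; apply: (sk_inj sk).
apply: eq_card => u; apply/idP/imsetP.
  move=> tu; have [y [Yy fy _]] := tok_sum tu; exists y => //.
  by rewrite inE Yy fy (tok_lev tu) eqxx.
case=> w; rewrite inE => /andP[Yw /eqP lw] ->; rewrite unfold_in /token lw eqxx /=.
by apply/existsP; exists w; rewrite Yw /=.
Qed.

Definition flat_lab u w := (index (if enum_rank u < enum_rank w then (u, w) else (w, u)) (flat_edges i)).+1.

Lemma glab_sym u w : flat_lab u w = flat_lab w u.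
Proof. by rewrite /flat_lab; case: (ltngtP (enum_rank u) (enum_rank w)) => // /val_inj/enum_rank_inj->. Qed.

Lemma glab_mem u w : e u w -> lev u = i -> lev w = i ->
  (if enum_rank u < enum_rank w then (u, w) else (w, u)) \in flat_edges i.
Proof.
move=> uw lu lw; rewrite mem_enum inE.
case: (ltngtP (enum_rank u) (enum_rank w)) => [rr|rr|/val_inj/enum_rank_inj E] /=.
- by rewrite uw lu lw !eqxx.
- by rewrite sym uw lu lw !eqxx.
- by rewrite E irr in uw.
Qed.

Lemma glab_range u w : e u w -> lev u = i -> lev w = i -> 0 < flat_lab u w <= nb_flat i.
Proof. by move=> uw lu lw; rewrite /flat_lab /= index_mem glab_mem. Qed.

Lemma glab_inj u w u' w' : e u w -> lev u = i -> lev w = i ->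
  e u' w' -> lev u' = i -> lev w' = i -> flat_lab u w = flat_lab u' w' ->
  (u = u' /\ w = w') \/ (u = w' /\ w = u').
Proof.
move=> uw lu lw uw' lu' lw' [E]; have h := glab_mem uw lu lw; have h' := glab_mem uw' lu' lw'.
have := nth_index (u, w) h; rewrite E (nth_index (u, w) h').
by case: ifP => _; case: ifP => _ [-> ->]; auto.
Qed.

Lemma glab_onto l : 0 < l <= nb_flat i ->
  exists u w, [/\ e u w, lev u = i, lev w = i & flat_lab u w = l].
Proof.
case: l => // l /= lG; have [q0 _] : {q : V * V | true} by move: lG; rewrite /nb_flat; case: (flat_edges i) => // q; exists q.
have := mem_nth q0 lG; case E: (nth q0 (flat_edges i) l) => [u w].
rewrite mem_enum inE /= => /and4P[uw /eqP lu /eqP lw rr]; exists u, w; split=> //.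
by rewrite /flat_lab rr -E index_uniq // enum_uniq.
Qed.

Variables (lab : V -> V -> nat) (P c0 : nat) (idx : V -> nat).
Hypothesis I : partial_labeling i.+1 lab P c0 idx.

Variables (lam : V -> V -> nat) (del : V -> nat) (Lam : nat).
Hypothesis HS : bip_labeling (free_rel i) [pred u | lev u == i] token lam del Lam.

Let m := nb_free i.
Let t := nb_tok i.
Let n := #|[pred v | lev v == i]|.
Let a := P + nb_flat i.
Let b := a + m.
Let Q := b + t.

Let mE : #|[pred p : V * V | free_rel i p.1 p.2]| = m. Proof. by []. Qed.

Lemma psE u : lev u = i -> upper_sum lab i.+1 u = \sum_(w | e u w && (i < lev w)) lab u w.
Proof.
move=> lu; apply: eq_bigl => w; case uw: (e u w) => //=.
by have [h1 h2] := lev_edge2 uw; apply/idP/idP; lia.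
Qed.

(** For a token the token edge is left out as well; what remains does not depend on the ranks still
    to be chosen. *)
Definition nonparent_sum u := \sum_(w | e u w && (i < lev w)) lab u w +
  \sum_(w | e u w && (lev w == i)) (P + flat_lab u w) + \sum_(w | free_rel i u w) (a + lam u w).

Let Lam_m : 2 * Lam <= m. Proof. exact: (H_Lam_m HS). Qed.

Let old_range u w : e u w -> i < maxn (lev u) (lev w) -> 0 < lab u w <= P.
Proof. by move=> uw iw; apply: (I_range I); rewrite /late uw. Qed.

Lemma part1 u : \sum_(w | e u w && (i < lev w)) lab u w <= du u * a.
Proof.
rewrite -sum_nat_const; apply: leq_sum => w /andP[uw iw].
by have := old_range uw (leq_trans iw (leq_maxr _ _)); rewrite /a; lia.
Qed.

Lemma part2 u : lev u = i -> \sum_(w | e u w && (lev w == i)) (P + flat_lab u w) <= su u * a.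
Proof.
move=> lu; rewrite -sum_nat_const; apply: leq_sum => w /andP[uw /eqP lw].
by have := glab_range uw lu lw; rewrite /a; lia.
Qed.

Lemma part3 u : \sum_(w | free_rel i u w) (a + lam u w) = hd u * a + \sum_(w | free_rel i u w) lam u w.
Proof. by rewrite big_split /= sum_nat_const. Qed.

(** There are [(2 * k).+1] labels, each at most [a] except for the parts [lam] of the free ones;
    [H_nontok] bounds these parts together by [k * m + (m - Lam)]. *)
Lemma psum_ord u : lev u = i -> ~~ token u -> nonparent_sum u + Lam <= k * (2 * a + m) + b.
Proof.
move=> lu nt; rewrite /nonparent_sum part3; have := part1 u; have := part2 lu.
have := H_nontok HS (u := u); rewrite /= lu eqxx => /(_ isT nt).
rewrite mE -/(hd u).
have := degE lu; rewrite udE // (negPf nt).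
move: (\sum_(w | e u w && (i < lev w)) _) (\sum_(w | e u w && (lev w == i)) _) (\sum_(w | _) _) (du u) (su u) (hd u).
move: Lam_m; rewrite /b; move: m a Lam => m' a' L; clear => Lm s1 s2 s3 c1 c2 c3 dE h3 h2 h1.
have hk : c3./2 <= k by lia.
have := leq_mul hk (leqnn m') => h4.
have E : (c1 + c2 + c3) * a' = (2 * k).+1 * a' by congr (_ * _); lia.
rewrite !mulnDl in E.
have E2 : (2 * k).+1 * a' = k * (2 * a') + a' by rewrite mulSn addnC mulnA [k * 2]mulnC.
rewrite mulnDr; lia.
Qed.

(** All edges at a token lead towards the root, and [2 * k] of them are free. *)
Lemma psum_tok u : token u -> nonparent_sum u = k * (2 * a + m) + del u.
Proof.
move=> tu; have lu := tok_lev tu; rewrite /nonparent_sum part3; have := part1 u; have := part2 lu.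
have -> : su u = 0 by have := degE lu; rewrite tok_ud //; lia.
have -> : du u = 0 by have := degE lu; rewrite tok_ud //; lia.
rewrite !mul0n !leqn0 => /eqP-> /eqP->.
rewrite (H_tok HS tu) mE -/(hd u) (tok_hd tu) !add0n.
by rewrite mul2n doubleK -mul2n mulnDr addnA mulnCA mulnA.
Qed.

Section Labelled.
Variables (rho tidx : V -> nat) (t0 : nat).
Hypothesis RK : ranking [pred v | lev v == i]
  [pred u | (#|[pred w | up u w]| == 2 * k + 2) && (lev u == i)] token del nonparent_sum Lam
  (k + nb_nonparent i.-1) rho tidx t0.

(* Label intervals in order: edges inside the level, free edges, token edges, parent
   edges. *)
Definition down_lab u w := if par u == w then Q + rho u
  else if Y w && (f w == u) then b + tidx u else a + lam u w.
Definition ext_lab u w := if i < maxn (lev u) (lev w) then lab u w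
  else if lev u == lev w then P + flat_lab u w
  else if lev w < lev u then down_lab u w else down_lab w u.

Lemma nlab_sym u w : ext_lab u w = ext_lab w u.
Proof.
rewrite /ext_lab maxnC (I_sym I) glab_sym [lev u == _]eq_sym.
by case: ifP => // _; case: (ltngtP (lev u) (lev w)).
Qed.

Lemma nlab_old u w : i < maxn (lev u) (lev w) -> ext_lab u w = lab u w.
Proof. by rewrite /ext_lab => ->. Qed.

Lemma nlab_G u w : lev u = i -> lev w = i -> ext_lab u w = P + flat_lab u w.
Proof. by move=> lu lw; rewrite /ext_lab lu lw maxnn ltnn eqxx. Qed.

Lemma nlab_down u w : lev u = i -> lev w < i -> ext_lab u w = down_lab u w.
Proof.
move=> lu lw; rewrite /ext_lab lu; have -> : i < maxn i (lev w) = false by lia.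
by rewrite lw; have -> : (i == lev w) = false by lia.
Qed.

Lemma nlab_S u : lev u = i -> ext_lab u (par u) = Q + rho u.
Proof.
move=> lu; have [_ ls] := par_up (nroot lu); rewrite nlab_down //; last by lia.
by rewrite /down_lab eqxx.
Qed.

Lemma nlab_N u w : lev u = i -> Y w -> f w = u -> ext_lab u w = b + tidx u.
Proof.
move=> lu Yw fw; have [_ ls] := Y_up Yw; rewrite nlab_down //; last by rewrite -lu -fw ls.
by rewrite /down_lab Yw fw eqxx (negPf (sk_Ysg sk Yw (nroot lu))).
Qed.

Lemma nlab_H u w : free_rel i u w -> ext_lab u w = a + lam u w.
Proof.
case/and5P=> uw /eqP luw /eqP lu /negPf sw /negPf nw; rewrite nlab_down //; last by lia.
by rewrite /down_lab sw nw.
Qed.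

Variant new_spec u w : nat -> Prop :=
  | NewG of lev w = i & 0 < flat_lab u w <= nb_flat i : new_spec u w (P + flat_lab u w)
  | NewH of free_rel i u w & 0 < lam u w <= m : new_spec u w (a + lam u w)
  | NewN of Y w & f w = u & token u & 0 < tidx u <= t : new_spec u w (b + tidx u)
  | NewS of par u = w & 0 < rho u <= n : new_spec u w (Q + rho u).

Lemma newP u w : e u w -> lev u = i -> lev w <= i -> new_spec u w (ext_lab u w).
Proof.
move=> uw lu lw; have [h1 h2] := lev_edge2 uw.
have [lwi|lwi] := eqVneq (lev w) i.
  by rewrite nlab_G //; apply: NewG => //; exact: glab_range.
have [sw|sw] := eqVneq (par u) w.
  by rewrite -{2}sw nlab_S //; apply: NewS => //; apply: (rho_range RK); rewrite inE lu.
have [/andP[Yw /eqP fw]|nY] := boolP (Y w && (f w == u)).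
  have tu : token u by rewrite /token lu eqxx; apply/existsP; exists w; rewrite Yw fw /=.
  rewrite nlab_N //; apply: NewN => //.
  by have := idx_range RK tu; rewrite card_tok.
have hh : free_rel i u w by rewrite /free_rel uw lu eqxx sw nY /= andbT; lia.
by rewrite nlab_H //; apply: NewH => //; exact: (H_range HS hh).
Qed.

Lemma lateP u w : late i u w -> late i.+1 u w \/
  exists u' w', [/\ (u' = u /\ w' = w) \/ (u' = w /\ w' = u), e u' w', lev u' = i & lev w' <= i].
Proof.
case/andP=> uw; rewrite leq_eqVlt => /orP[/eqP E|im]; last by left; rewrite /late uw.
right; case: (leqP (lev w) (lev u)) => h.
  by exists u, w; split; [by left | by [] | lia | lia].
by exists w, u; split; [by right | by rewrite sym | lia | lia].
Qed.

Lemma new_range u w : e u w -> lev u = i -> lev w <= i -> P < ext_lab u w <= Q + n.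
Proof. by move=> uw lu lw; case: (newP uw lu lw) => *; rewrite /Q /b /a; lia. Qed.

Lemma late_old u w : late i.+1 u w -> e u w /\ ext_lab u w = lab u w.
Proof. by case/andP=> uw iw; rewrite nlab_old. Qed.

Let nrange u w : late i u w -> 0 < ext_lab u w <= Q + n.
Proof.
case/lateP=> [l1|[u' [w' [[[-> ->]|[-> ->]] uw lu lw]]]].
- have [uw ->] := late_old l1; have := I_range I l1; rewrite /Q /b /a; lia.
- by have := new_range uw lu lw; lia.
- by rewrite nlab_sym; have := new_range uw lu lw; lia.
Qed.

Let nonto l : 0 < l <= Q + n -> exists u w, late i u w /\ ext_lab u w = l.
Proof.
move=> lr; have lateu u w : e u w -> lev u = i -> late i u w.
  by move=> uw lu; rewrite /late uw lu leq_maxl.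
case: (leqP l P) => lP.
  have [|u [w [uw <-]]] := I_onto I (l := l); first by lia.
  exists u, w; have [ew ->] := late_old uw; split=> //.
  by move: uw; rewrite /late ew /=; exact: ltnW.
case: (leqP l a) => la.
  have [|u [w [uw lu lw E]]] := @glab_onto (l - P); first by rewrite /a in la; lia.
  by exists u, w; rewrite nlab_G // E lateu //; split=> //; lia.
case: (leqP l b) => lb.
  have [|u [w [uw E]]] := H_onto HS (l := l - a).
    by rewrite mE; rewrite /b in lb; lia.
  exists u, w; rewrite nlab_H // E; case/and5P: uw => uw _ /eqP lu _ _.
  by rewrite lateu //; split=> //; lia.
case: (leqP l Q) => lQ.
  have [|||u tu E] := @range_onto _ token tidx 1 (l - b).
  - by move=> u tu; have := idx_range RK tu; lia.
  - exact: idx_inj RK.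
  - by rewrite card_tok -/t; rewrite /Q in lQ; lia.
  have [y [Yy fy _]] := tok_sum tu; have lu := tok_lev tu.
  exists u, y; rewrite (nlab_N lu Yy fy) E; split; last by lia.
  by rewrite lateu // -fy; case: (Y_up Yy).
have [|||u lu E] := @range_onto _ [pred v | lev v == i] rho 1 (l - Q).
- by move=> u lu; have := rho_range RK lu; lia.
- exact: rho_inj RK.
- by rewrite -/n; lia.
move/eqP: lu => lu; exists u, (par u); rewrite nlab_S // E; split; last by lia.
by rewrite lateu //; case: (par_up (nroot lu)).
Qed.

Let ninj u w u' w' : late i u w -> late i u' w' -> ext_lab u w = ext_lab u' w' ->
  (u = u' /\ w = w') \/ (u = w' /\ w = u').
Proof.
have new u1 w1 u2 w2 : e u1 w1 -> lev u1 = i -> lev w1 <= i -> e u2 w2 -> lev u2 = i ->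
    lev w2 <= i -> ext_lab u1 w1 = ext_lab u2 w2 -> (u1 = u2 /\ w1 = w2) \/ (u1 = w2 /\ w1 = u2).
  move=> e1 lu1 lw1 e2 lu2 lw2.
  case: (newP e1 lu1 lw1) => [g1 r1|h1 r1|y1 f1 k1' r1|s1 r1];
  case: (newP e2 lu2 lw2) => [g2 r2|h2 r2|y2 f2 k2' r2|s2 r2] E;
    try (by exfalso; move: E r1 r2; rewrite /Q /b /a; lia).
  - by apply: glab_inj => //; apply: (@addnI P).
  - by left; apply: (H_inj HS h1 h2); apply: (@addnI a).
  - have uu : u1 = u2 by apply: (idx_inj RK k1' k2'); apply: (@addnI b).
    by left; split=> //; apply: (sk_inj sk) => //; rewrite f1 f2.
  - have uu : u1 = u2 by apply: (rho_inj RK); rewrite ?inE ?lu1 ?lu2 //; apply: (@addnI Q).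
    by left; split=> //; rewrite -s1 -s2 uu.
case/lateP=> [l1|[u1 [w1 [s1 e1 lu1 lw1]]]]; case/lateP=> [l2|[u2 [w2 [s2 e2 lu2 lw2]]]].
- by have [_ ->] := late_old l1; have [_ ->] := late_old l2; apply: (I_inj I).
- have [_ ->] := late_old l1; have := I_range I l1; have := new_range e2 lu2 lw2.
  by case: s2 => -[-> ->]; rewrite 1?(nlab_sym w' u'); lia.
- have [_ ->] := late_old l2; have := I_range I l2; have := new_range e1 lu1 lw1.
  by case: s1 => -[-> ->]; rewrite 1?(nlab_sym w u); lia.
- have := new _ _ _ _ e1 lu1 lw1 e2 lu2 lw2.
  case: s1 => -[-> ->]; case: s2 => -[-> ->]; rewrite ?(nlab_sym w u) ?(nlab_sym w' u') => h /h; tauto.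
Qed.

Let nord u w u' w' : late i u w -> late i u' w' ->
  maxn (lev u) (lev w) < maxn (lev u') (lev w') -> ext_lab u' w' < ext_lab u w.
Proof.
move=> l l' ml; have l2 : late i.+1 u' w'.
  by move: l l'; rewrite /late => /andP[_ h] /andP[-> _] /=; apply: leq_ltn_trans ml.
have [_ ->] := late_old l2; case/lateP: l => [l1|[u1 [w1 [s1 e1 lu1 lw1]]]].
  by have [_ ->] := late_old l1; apply: (I_ord I).
have := I_range I l2; have := new_range e1 lu1 lw1.
by case: s1 => -[-> ->]; rewrite 1?(nlab_sym w u); lia.
Qed.

Lemma phi_old u : i < lev u -> phi ext_lab u = phi lab u.
Proof. by move=> iu; apply: eq_bigr => w _; rewrite nlab_old // leq_max iu. Qed.

Lemma phi_new u : lev u = i ->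
  phi ext_lab u = nonparent_sum u + (if token u then b + tidx u else 0) + (Q + rho u).
Proof.
move=> lu; rewrite /phi sum_nbr // sum_down_nbr // nlab_S // /nonparent_sum.
rewrite (eq_bigr (fun w => lab u w)) => [|w /andP[_ iw]]; last by rewrite nlab_old // leq_max iw orbT.
rewrite [X in _ + X + _](eq_bigr (fun w => P + flat_lab u w)) => [|w /andP[_ /eqP lw]]; last exact: nlab_G.
rewrite [X in _ + (X + _ + _)](eq_bigr (fun w => a + lam u w)) => [|w]; last exact: nlab_H.
have -> : \sum_(w | Y w && (f w == u)) ext_lab u w = if token u then b + tidx u else 0.
  case tu: (token u); last by rewrite nontok_sum ?tu.
  by have [y [Yy fy ->]] := tok_sum tu; rewrite (nlab_N lu Yy fy).
by move: (\sum_(w | _) _) (\sum_(w | _) _) (\sum_(w | _) _) (if _ then _ else _) (Q + rho u); clear; lia.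
Qed.

Let base := k * (2 * a + m) + b + Q.

Lemma phi_tok u : token u -> phi ext_lab u = base + (del u + tidx u + rho u).
Proof. by move=> tu; rewrite phi_new ?tok_lev // tu psum_tok // /base; lia. Qed.

Lemma phi_ord u : lev u = i -> ~~ token u -> phi ext_lab u = nonparent_sum u + (Q + rho u).
Proof. by move=> lu nt; rewrite phi_new // (negPf nt) addn0. Qed.

(** [tok_sum_gt] puts the tokens strictly above this bound. *)
Lemma phi_ord_le u : lev u = i -> ~~ token u -> phi ext_lab u + Lam + t0 <= base + n.
Proof.
move=> lu nt; rewrite phi_ord // /base.
by have := psum_ord lu nt; have := rho_ord RK (u := u); rewrite inE lu eqxx -/n => /(_ isT nt); lia.
Qed.

Lemma phi_same u v : lev u = i -> lev v = i -> phi ext_lab u = phi ext_lab v -> u = v.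
Proof.
move=> lu lv'; case: (boolP (token u)) => tu; case: (boolP (token v)) => tv.
- by rewrite !phi_tok // => /addnI; apply: (tok_sum_inj RK).
- by rewrite phi_tok //; have := phi_ord_le lv' tv; have := tok_sum_gt RK tu; rewrite -/n; lia.
- by rewrite [RHS]phi_tok //; have := phi_ord_le lu tu; have := tok_sum_gt RK tv; rewrite -/n; lia.
- move=> E; apply/eqP; apply: contraT => uv; move: E; rewrite !phi_ord //.
  by have := rho_mono RK (u := u) (v := v); rewrite !inE lu lv' eqxx => /(_ isT tu isT tv uv); lia.
Qed.

Lemma gN_next : nb_tok i.+1 = #|[pred w | Y w & lev w == i]|.
Proof.
apply: eq_card => w; rewrite !inE; case Yw: (Y w) => //=.
by have [_ ->] := Y_up Yw; rewrite eqSS.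
Qed.

(** Besides the edges to the farther level only one edge is left, and it is the parent edge. *)
Lemma Y_deg u : Y u -> lev u = i -> [/\ ~~ token u, su u = 0, hd u = 0 & ud u = 1].
Proof.
move=> Yu lu; have := sk_Ydown sk Yu; rewrite -/(down_deg u) ddE // => dE.
have := degE lu; rewrite dE udE //; case: (token u) => /=; first by lia.
by move=> E; split=> //; lia.
Qed.

Lemma psum_Y u : Y u -> lev u = i -> nonparent_sum u = c0 + idx u.
Proof.
move=> Yu lu; have [_ su0 hd0 _] := Y_deg Yu lu; rewrite /nonparent_sum part3 -psE //.
rewrite hd0 mul0n add0n (eq_bigl xpred0) => [|w]; last by have := card0_eq su0 w; rewrite !inE.
rewrite [X in _ + _ + X](eq_bigl xpred0) => [|w]; last by have := card0_eq hd0 w; rewrite !inE.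
rewrite !big_pred0 // !addn0; have [|-> _ //] := I_Y I Yu.
by rewrite lu.
Qed.

(** The edges of [u] added here, parent edge excepted, number [(2 * k).+1 - down_deg u] and have
    labels above [P]; [I_nonY] counts [P.+1] for each. *)
Lemma psum_nonY u : ~~ Y u -> lev u = i ->
  c0 + nb_tok i.+1 < nonparent_sum u + (if token u then b + tidx u else 0).
Proof.
move=> nY lu; have := I_nonY I (nroot lu) nY; rewrite lu => /(_ erefl).
rewrite psE // ddE // => h; apply: leq_trans h _.
rewrite /nonparent_sum -!addnA leq_add2l.
have -> : (2 * k).+1 - du u = su u + (hd u + token u) by have := degE lu; rewrite udE //; lia.
rewrite !mulnDl; apply: leq_add; [|apply: leq_add].
- rewrite -sum_nat_const; apply: leq_sum => w /andP[uw /eqP lw].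
  by have := glab_range uw lu lw; lia.
- rewrite -sum_nat_const; apply: leq_sum => w hw.
  by have := H_range HS hw; rewrite /a; lia.
- case: ifP => tu; last by rewrite mul0n.
  by have := idx_range RK tu; rewrite mul1n /b /a; lia.
Qed.

Lemma card_Y_U : nb_tok i.+1 +
  #|[pred u | (#|[pred w | up u w]| == 2 * k + 2) && (lev u == i)]| <= n.
Proof.
rewrite gN_next /n -(cardID [pred w | Y w] [pred v | lev v == i]); apply: leq_add.
  by apply/subset_leq_card/subsetP=> w; rewrite !inE andbC.
apply/subset_leq_card/subsetP=> w; rewrite !inE => /andP[/eqP uw /eqP lw].
rewrite lw eqxx andbT; apply/negP=> Yw; have [_ _ _] := Y_deg Yw lw.
by rewrite /ud uw; lia.
Qed.

Lemma phi_Y u : Y u -> lev u = i ->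
  0 < idx u <= nb_tok i.+1 /\ phi ext_lab u = c0 + P + nb_nonparent i + 2 * idx u.
Proof.
move=> Yu lu; have [nt _ _ _] := Y_deg Yu lu.
have [|_ ir] := I_Y I Yu; first by rewrite lu.
split=> //; have pY v : Y v -> lev v = i -> [/\ nonparent_sum v = c0 + idx v, 0 < idx v <= nb_tok i.+1 & ~~ token v].
  move=> Yv lv'; rewrite psum_Y //; have [ntv _ _ _] := Y_deg Yv lv'.
  by have [|_ ->] := I_Y I Yv; rewrite ?lv'.
have pnY v : ~~ Y v -> lev v = i -> ~~ token v -> c0 + nb_tok i.+1 < nonparent_sum v.
  by move=> nY lv' ntv; have := psum_nonY nY lv'; rewrite (negPf ntv) addn0.
have [pu _ _] := pY _ Yu lu.
(* The sums of [Y] fill [c0 + 1] to [c0 + nb_tok i.+1] without gaps, and every other non-token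
   vertex lies above them. *)
have cE : #|[pred v | [&& lev v == i, ~~ token v & nonparent_sum v < nonparent_sum u]]| = (idx u).-1.
  transitivity #|[pred v | [pred w | Y w & lev w == i] v && (idx v < 1 + (idx u).-1)]|.
    apply: eq_card => v; rewrite !inE pu; case: eqP => lv'; rewrite ?andbF //= andbT.
    case: (boolP (Y v)) => Yv; first by have [-> _ ->] := pY _ Yv lv'; rewrite /=; lia.
    apply/negP=> /andP[ntv]; have := pnY _ Yv lv' ntv; lia.
  apply: range_count.
  - move=> v /andP[Yv /eqP lv']; rewrite -gN_next; have [_ h _] := pY _ Yv lv'; lia.
  - move=> v v' /andP[Yv /eqP lv1] /andP[Yv' /eqP lv2]; apply: (I_Yinj I) => //; first by rewrite lv1.
    by rewrite lv2.
  - by rewrite -gN_next; lia.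
(* [rho_first] applies because, by [card_Y_U], the ranks up to [nb_tok i.+1] stay free of tokens. *)
have rE : rho u = idx u.
  have lu' : [pred v | lev v == i] u by rewrite /= lu.
  rewrite (rho_first RK lu' nt).
  - by have -> : #|[pred v | [&& [pred v | lev v == i] v, ~~ token v & nonparent_sum v < nonparent_sum u]]| = (idx u).-1 by []; lia.
  - have -> : #|[pred v | [&& [pred v | lev v == i] v, ~~ token v & nonparent_sum v < nonparent_sum u]]| = (idx u).-1 by [].
    by apply: leq_trans card_Y_U; rewrite -addSn leq_add //; move: ir; clear; lia.
  - move=> v /eqP lv' ntv; case: (boolP (Y v)) => Yv.
      have [-> _ _] := pY _ Yv lv'; rewrite pu => /addnI; apply: (I_Yinj I) => //; first by rewrite lv'.
      by rewrite lu.
    by have := pnY _ Yv lv' ntv; lia.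
by rewrite phi_ord // pu rE /Q /b /a /nb_nonparent -/m -/t; lia.
Qed.

(** The sum without the parent edge exceeds [c0 + nb_tok i.+1] and the rank exceeds [nb_tok i.+1];
    each contributes 1 to the final 2. *)
Lemma phi_nonY u : ~~ Y u -> lev u = i -> c0 + P + nb_nonparent i + 2 * nb_tok i.+1 + 2 <= phi ext_lab u.
Proof.
move=> nY lu; have := psum_nonY nY lu; rewrite phi_new //.
have rg : nb_tok i.+1 < rho u.
  case: (boolP (token u)) => tu.
    by have := leq_ltn_trans card_Y_U (rho_tok RK tu); rewrite ltn_add2r.
  have lu' : [pred v | lev v == i] u by rewrite /= lu.
  apply: leq_ltn_trans (rho_gt RK lu' tu); rewrite gN_next.
  apply/subset_leq_card/subsetP=> v; rewrite !inE => /andP[Yv /eqP lv'].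
  have [ntv _ _ _] := Y_deg Yv lv'.
  have := psum_nonY nY lu; rewrite (negPf tu) addn0 (psum_Y Yv lv').
  have [|_ ir] := I_Y I Yv; first by rewrite lv'.
  by rewrite lv' eqxx ntv /=; lia.
move: (if token u then _ else _) (nonparent_sum u) => x y; rewrite /Q /b /a /nb_nonparent -/m -/t; lia.
Qed.

Let nphi u v : i <= lev u -> i <= lev v -> phi ext_lab u = phi ext_lab v -> u = v.
Proof.
(* Level [i] against level [i.+1]: for [x] in [Y] the stored [I_phi_ne] forbids equality, for the
   others [I_phi_lt] does. *)
have mixed x y : lev x = i -> i < lev y -> phi ext_lab x <> phi ext_lab y.
  move=> lx iy; case: (ltnP i.+1 (lev y)) => iy1.
    have := phi_far nord (u := x) (v := y); rewrite lx => /(_ (leqnn _) iy1) h E.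
    by rewrite E ltnn in h.
  have ly : lev y = i.+1 by lia.
  have nry : ~~ rt y by apply/negP=> ry; apply: (lev_root_gap lv ry (v := x)); rewrite lx.
  rewrite (phi_old iy) => E; case: (boolP (Y x)) => Yx.
    have [ir Ex] := phi_Y Yx lx.
    by have := I_phi_ne I nry ly ir; rewrite -E Ex eqxx.
  by have := phi_nonY Yx lx; have := I_phi_lt I nry ly; rewrite E /=; lia.
move=> iu iv; case: (ltngtP i (lev u)) iu => // iu _; case: (ltngtP i (lev v)) iv => // iv _.
- by rewrite !phi_old //; apply: (I_phi I).
- by move=> E; case: (mixed v u).
- by move=> E; case: (mixed u v).
- by apply: phi_same.
Qed.

Let nsg u v w : lev u = i -> lev v = i -> e u w -> w != par u -> ext_lab u w < ext_lab v (par v).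
Proof.
move=> lu lv' uw ws; rewrite nlab_S //; have := rho_range RK (u := v); rewrite inE lv' eqxx => /(_ isT).
case: (leqP (lev w) i) => lw rr.
  case: (newP uw lu lw) => [g1 r1|h1 r1|y1 f1 k1' r1|s1 r1]; try (by rewrite /Q /b /a; lia).
  by rewrite s1 eqxx in ws.
by rewrite nlab_old ?leq_max ?lw ?orbT //; have := old_range uw (leq_trans lw (leq_maxr _ _)); rewrite /Q /b /a; lia.
Qed.

Let hw w := #|[pred u | free_rel i u w]|.
Let xw w := #|[pred u | [&& e w u, lev u == i & par u == w]]|.

Lemma ddw w : (lev w).+1 = i -> down_deg w = hw w + xw w + Y w.
Proof.
move=> lw; transitivity (\sum_(u | e w u && (lev u == i)) 1).
  by rewrite sum1_card; apply: eq_card => u; rewrite !inE lw sym.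
by rewrite sum_up_nbr // /hw /xw -!sum1_card; case: (Y w).
Qed.

Lemma psw w : (lev w).+1 = i -> upper_sum ext_lab i w = hw w * a + \sum_(u | free_rel i u w) lam u w +
  \sum_(u | [&& e w u, lev u == i & par u == w]) (Q + rho u) + (if Y w then b + tidx (f w) else 0).
Proof.
move=> lw; rewrite /upper_sum sum_up_nbr // -[hw w * a]sum_nat_const -big_split /=.
congr (_ + _ + _).
- by apply: eq_bigr => u hu; rewrite nlab_sym nlab_H.
- by apply: eq_bigr => u /and3P[_ /eqP lu /eqP su']; rewrite nlab_sym -{1}su' nlab_S.
- by case Yw: (Y w) => //; rewrite nlab_sym nlab_N //; have [_ ->] := Y_up Yw.
Qed.

Let tokf w : Y w -> (lev w).+1 = i -> token (f w).
Proof.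
move=> Yw lw; have [_ lf] := Y_up Yw; rewrite /token /= lf lw eqxx /=.
by apply/existsP; exists w; rewrite Yw /=.
Qed.

(** [w] is nobody's parent, so it has [2 * k] free edges and the token edge here; as [2 * k] is
    even, [H_Weven] gives the labels [lam] the exact sum [k * m.+1]. *)
Let nY w : Y w -> (lev w).+1 = i ->
  upper_sum ext_lab i w = k * (2 * a + m + 1) + b + tidx (f w) /\ 0 < tidx (f w) <= t.
Proof.
move=> Yw lw; split; last by have := idx_range RK (tokf Yw lw); rewrite card_tok.
have x0 : xw w = 0.
  apply: eq_card0 => u; rewrite !inE; apply/negP=> /and3P[_ /eqP lu su'].
  by have := sk_Ysg sk Yw (nroot lu); rewrite su'.
have hE : hw w = 2 * k.
  by have := ddw lw; rewrite /down_deg (sk_Ydown sk Yw) Yw x0; lia.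
have z : \sum_(u | [&& e w u, lev u == i & par u == w]) (Q + rho u) = 0.
  by apply: big_pred0 => u; have := card0_eq x0 u; rewrite !inE.
rewrite psw // Yw z addn0 hE.
have nw : ~~ [pred u | lev u == i] w by rewrite /= -lw; lia.
have := H_Weven HS nw; rewrite -/(hw w) hE mul2n odd_double doubleK => /(_ isT) ->.
rewrite mE; clear; nia.
Qed.

Let nnonY w : ~~ rt w -> ~~ Y w -> (lev w).+1 = i ->
  k * (2 * a + m + 1) + b + t < upper_sum ext_lab i w + ((2 * k).+1 - down_deg w) * (Q + n).+1.
Proof.
move=> nw nYw lw; rewrite psw // (negPf nYw) addn0.
have h1 : xw w * Q.+1 <= \sum_(u | [&& e w u, lev u == i & par u == w]) (Q + rho u).
  rewrite -sum_nat_const; apply: leq_sum => u /and3P[_ lu _].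
  by have := rho_range RK (u := u) lu; lia.
have nw' : ~~ [pred u | lev u == i] w by rewrite /= -lw; lia.
have := H_W HS nw'; rewrite mE -/(hw w) => h2.
have dE := ddw lw; rewrite (negPf nYw) addn0 in dE.
have ddle : down_deg w <= (2 * k).+1.
  have [ew ls] := par_up nw.
  have := reg w; rewrite (cardD1 (par w)) inE ew add1n addn2 => -[<-].
  apply/subset_leq_card/subsetP=> u; rewrite !inE sym => /andP[-> /eqP lu].
  by rewrite andbT; apply/eqP=> us; rewrite us in lu; lia.
(* A vertex outside [Y] is somebody's parent or has an edge to be labelled later besides its parent
   edge. *)
have r1 : 0 < xw w + ((2 * k).+1 - down_deg w).
  case: (ltngtP (down_deg w) (2 * k).+1) ddle => // [|dk _]; first by lia.
  have [v nv sv] := sk_nonY sk nw nYw dk.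
  have [ev ls] := par_up nv; rewrite addn_gt0; apply/orP; left; apply/card_gt0P; exists v.
  by rewrite inE -sv sym ev ls sv lw !eqxx.
have h3 : ((2 * k).+1 - down_deg w) * Q.+1 <= ((2 * k).+1 - down_deg w) * (Q + n).+1.
  by rewrite leq_mul2l ltnS leq_addr orbT.
move: h1 h2 h3 r1 dE ddle; move: (down_deg w) (xw w) (hw w) (\sum_(u | _) _) (\sum_(u | _) _) (_ * (Q + n).+1).
rewrite /Q /b; move: a m t => a' m' t'; clear => d x h s1 s2 s3 h1 h2 h3 r1 dE ddle.
have xr : x + ((2 * k).+1 - d) + h = (2 * k).+1 by lia.
move: h3 r1 xr; clear dE ddle; move: ((2 * k).+1 - d) => y h3 r1 xr.
(* One of the [x + y] labels above [Q] pays for [b + t]; the other [r] and the [h] free edges, with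
   [r + h = 2 * k], pay for [k * (2 * a + m + 1)]. *)
have [r rE] : exists r, x + y = r.+1 by exists (x + y).-1; lia.
have e1 : (x + y) * (a' + m' + t').+1 <= s2 + s3 by rewrite mulnDl leq_add.
rewrite rE mulSn in e1.
have e2 : r * (a' + m'.+1) <= r * (a' + m' + t').+1 by rewrite leq_mul2l; lia.
rewrite mulnDr in e2.
have e3 : k <= r + h./2 by lia.
have e4 := leq_mul e3 (leqnn m'.+1); rewrite mulnDl in e4.
have e5 : (r + h) * a' = 2 * k * a' by congr (_ * _); lia.
rewrite mulnDl in e5.
have e6 : k * (2 * a' + m' + 1) = 2 * k * a' + k * m'.+1 by rewrite -addnA addn1 mulnDr mulnA [k * 2]mulnC.
rewrite e6; move: h2; move: (nat_of_bool _) => o h2.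
lia.
Qed.

Lemma partial_labeling_step : partial_labeling i ext_lab (Q + n) (k * (2 * a + m + 1) + b) (fun w => tidx (f w)).
Proof.
have gNt : nb_tok i = t by [].
split.
- exact: nlab_sym.
- exact: nrange.
- exact: nonto.
- exact: ninj.
- exact: nord.
- exact: nphi.
- by move=> u v w _ _; apply: nsg.
- exact: nY.
- move=> w w' Yw Yw' lw lw' E; apply: (sk_inj sk) => //.
  by apply: (idx_inj RK) E; apply: tokf.
- exact: nnonY.
- move=> u _ lu; have t0t := t0_le RK; rewrite card_tok -/t in t0t; rewrite gNt.
  (* The new offset plus the new number of labels is [base + n + k]. Measured from [base], the
     values to avoid are [n + k + nb_nonparent i.-1 + 2 * x], whence the [beta] passed to
     [ranking]. *)
  have bE : k * (2 * a + m + 1) + b + (Q + n) = base + n + k by rewrite /base mulnDr muln1; lia.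
  rewrite bE; case: (boolP (token u)) => tu.
    by rewrite phi_tok //; have := tok_sum_le RK tu; rewrite -/n; lia.
  by have := phi_ord_le lu tu; lia.
- move=> u x _ lu /andP[x0 xt].
  have bE : k * (2 * a + m + 1) + b + (Q + n) = base + n + k by rewrite /base mulnDr muln1; lia.
  rewrite bE; case: (boolP (token u)) => tu.
    rewrite phi_tok //; have := tok_sum_ne RK tu x0; rewrite -/n; apply: contra => /eqP E.
    by apply/eqP; lia.
  by have := phi_ord_le lu tu; apply: contraTneq => ->; lia.
Qed.
End Labelled.
End Step.
End Levels.

(** * Descent to level 0 and the antimagic labeling *)

Section Descent.
Variables (V : finType) (e : rel V) (k : nat) (lev : V -> nat) (rt : pred V).
Variables (par : V -> V) (Y : pred V) (f : V -> V).
Local Notation up := [rel u w | e u w && (lev u == (lev w).+1)].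
Hypothesis sym : symmetric e.
Hypothesis irr : irreflexive e.
Hypothesis k1 : 0 < k.
Hypothesis reg : forall u, #|[pred v | e u v]| = 2 * k + 2.
Hypothesis lv : leveling e lev rt.
Hypothesis sk : skeleton e k lev rt up par Y f.

Lemma partial_labeling_descend i : (exists lab P c0 idx, partial_labeling e k lev rt par Y f i.+1 lab P c0 idx) ->
  exists lab P c0 idx, partial_labeling e k lev rt par Y f i lab P c0 idx.
Proof.
case=> lab [P [c0 [idx I]]].
case: (pickP [pred r | rt r && (lev r == i)]) => [r /andP[rr /eqP lr]|nr].
  by do 4 eexists; exact: (partial_labeling_root sym k1 reg lv sk rr lr I).
have nroot v : lev v = i -> ~~ rt v.
  by move=> lvi; have := nr v; rewrite /= lvi eqxx andbT => ->.
have hU u w : free_rel e lev par Y f i u w -> [pred u | lev u == i] u && ~~ [pred u | lev u == i] w.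
  by case/and5P=> _ /eqP luw /eqP lu _ _; rewrite /= lu eqxx /=; lia.
have tokE u : token lev Y f i u ->
    [pred u | lev u == i] u && ~~ odd #|[pred w | free_rel e lev par Y f i u w]|.
  by move=> tu; rewrite (tok_hd k1 sk nroot tu) mul2n odd_double andbT; case/andP: tu.
have [lam [del [Lam HS]]] := bipartite_labeling hU tokE.
have cardU : (2 * k).+1 * #|token lev Y f i| <=
    #|[pred u | (#|[pred w | up u w]| == 2 * k + 2) && (lev u == i)]|.
  by rewrite (card_tok sk); exact: (sk_count sk).
(* Each token has [2 * k] free edges, so [H_Lam_deg] halves to this bound. *)
have LamE : Lam <= k * #|token lev Y f i|.
  have := H_Lam_deg HS; rewrite (eq_bigr (fun=> 2 * k)) => [|u tu]; last exact: (tok_hd k1 sk nroot tu).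
  by rewrite sum_nat_const mulnCA leq_pmul2l // mulnC.
have [||rho [tidx [t0 RK]]] := token_ranks (A := [pred v | lev v == i])
    (nonparent_sum e lev par Y f i lab P lam) (k + nb_nonparent e lev par Y f i.-1) k1 _ _ cardU (H_del HS) LamE.
- by move=> u tu; rewrite /= (tok_ud sk tu) eqxx; case/andP: tu.
- by move=> u /andP[].
have J := partial_labeling_step sym irr k1 reg lv sk nroot I HS RK.
by do 4 eexists; exact: J.
Qed.

Lemma partial_labeling_exists : exists lab P c0 idx, partial_labeling e k lev rt par Y f 0 lab P c0 idx.
Proof.
have [i I] := partial_labeling_start k1 sk; elim: i I => // i IH /partial_labeling_descend.
exact: IH.
Qed.
End Descent.

Theorem theorem3p1 (k : nat) (hk : 1 <= k) (V : finType) (e : rel V)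
  (he : simple_graph e) (hreg : regular e (2 * k + 2)) : antimagic e.
Proof.
have [sym irr] := he.
have reg u : #|[pred v | e u v]| = 2 * k + 2 by rewrite -(hreg u) cardsE.
have [lev [rt lv]] := leveling_exists sym irr.
have [par [Y [g sk]]] := skeleton_exists sym reg lv.
have [lab [P [c0 [idx I]]]] := partial_labeling_exists sym irr hk reg lv sk.
have lateE u v : late e lev 0 u v = e u v by rewrite /late andbT.
(* [lab] is symmetric, so the orientation picked for an edge does not matter; 0 is a dummy value off
   the edges. *)
pose f (A : {set V}) := if [pick p : V * V | e p.1 p.2 && (A == [set p.1; p.2])] is Some p
  then lab p.1 p.2 else 0.
have set2_eq (u v u' v' : V) : u != v -> [set u; v] = [set u'; v'] -> (u = u' /\ v = v') \/ (u = v' /\ v = u').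
  move=> uv E; have := set21 u v; have := set22 u v; rewrite E !inE.
  by move=> /orP[]/eqP vE /orP[]/eqP uE; rewrite ?uE ?vE ?eqxx // in uv *; [right | left].
have fE u v : e u v -> f [set u; v] = lab u v.
  move=> uv; rewrite /f; case: pickP => [[x y] /= /andP[xy /eqP]|/(_ (u, v))]; last by rewrite /= uv eqxx.
  have ne : u != v by apply: contraTneq uv => ->; rewrite irr.
  by case/(set2_eq _ _ _ _ ne) => -[<- <-] //; rewrite (I_sym I).
have edgeP A : reflect (exists u v, e u v /\ A = [set u; v]) (A \in edges e).
  apply: (iffP imsetP) => [[[u v]]|[u [v [uv ->]]]].
    by rewrite inE => uv ->; exists u, v.
  by exists (u, v); rewrite ?inE.
have fr A : A \in edges e -> 0 < f A <= P.
  by case/edgeP=> u [v [uv ->]]; rewrite fE //; apply: (I_range I); rewrite lateE.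
have finj : {in edges e &, injective f}.
  move=> A B /edgeP[u [v [uv ->]]] /edgeP[u' [v' [uv' ->]]]; rewrite !fE // => E.
  have [||[-> ->]|[-> ->]] // := I_inj I (u := u) (v := v) (u' := u') (v' := v') _ _ E.
  - by rewrite lateE.
  - by rewrite lateE.
  - by rewrite setUC.
have fonto l : 0 < l <= P -> exists2 A, A \in edges e & f A = l.
  move=> /(I_onto I)[u [v []]]; rewrite lateE => uv <-.
  by exists [set u; v]; [apply/edgeP; exists u, v | exact: fE].
(* [f] maps the edges bijectively onto the labels from 1 to [P], which forces [P]. *)
have PE : #|edges e| = P.
  have : perm_eq (map f (enum (edges e))) (iota 1 P).
    apply: uniq_perm (iota_uniq _ _) _.
      by rewrite map_inj_in_uniq ?enum_uniq // => A B; rewrite !mem_enum; apply: finj.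
    move=> l; rewrite mem_iota add1n ltnS; apply/mapP/idP => [[A]|].
      by rewrite mem_enum => /fr + ->.
    by case/fonto=> A Ae <-; exists A; rewrite ?mem_enum.
  by move/perm_size; rewrite size_map -cardE size_iota.
exists f; split; first by split; rewrite ?PE.
have sumE u : vertex_sum e f u = phi e lab u.
  rewrite /vertex_sum /phi.
  have -> : incident_edges e u = [set [set u; v] | v in [pred v | e u v]].
    apply/setP=> A; rewrite inE; apply/andP/imsetP.
      case=> /edgeP[x [y [xy ->]]]; rewrite !inE => /orP[]/eqP->; first by exists y.
      by exists x; rewrite ?inE 1?sym // setUC.
    case=> v; rewrite inE => uv ->; split; last exact: set21.
    by apply/edgeP; exists u, v.
  rewrite big_imset /=; first by apply: eq_bigr => v; exact: fE.
  move=> v v'; rewrite !inE => uv uv' E.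
  have ne : u != v by apply: contraTneq uv => ->; rewrite irr.
  by case: (set2_eq _ _ _ _ ne E) => [[]|[-> ->]].
move=> u v uv; rewrite !sumE => E; move: uv.
by rewrite (I_phi I (leq0n _) (leq0n _) E) eqxx.
Qed.
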